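(* Let $p\ge5$ be a prime and $r\in\mathbb{Z}_{\ge1}$. Then \[ S_3^{\mathrm{Leg}}(p^r)=\begin{cases}-4p^r+E_3(p^r)&\text{if }p^r\equiv1\pmod4,\\0&\text{if }p^r\equiv3\pmod4,\end{cases} \] where \[ E_3(p^r)=-\left(\frac{2}{p^r}\right)\left(c_{g_2}(p^r)-\left(\frac{-1}{p}\right)p^4c_{g_2}(p^{r-2})\right), \] with $c_{g_2}(p^{-1}):=0$.
   Context: Legendre family: for $\lambda\in\mathbb{F}_{p^r}$, $E_\lambda: y^2=x(x-1)(x-\lambda)$, with $\mathrm{tr}(E_\lambda):=p^r+1-|E_\lambda(\mathbb{F}_{p^r})|$ (points counted including the point at infinity; the same definition for the singular curves $\lambda=0,1$). $S_k^{\mathrm{Leg}}(p^r):=\sum_{\lambda\in\mathbb{F}_{p^r}}\mathrm{tr}(E_\lambda)^k$. $\left(\frac{\cdot}{\cdot}\right)$ is the Jacobi symbol. With $q=e^{2\pi i\tau}$ and $\eta(\tau)=q^{1/24}\prod_{n\ge1}(1-q^n)$, $g_2\in S_5(\Gamma_0(64),\chi_{-4})$ ($\chi_{-4}$ the non-principal character modulo 4) is the newform with LMFDB label 64.5.c.a, $g_2(\tau)=\sum_{n\ge1}c_{g_2}(n)q^n=\frac{\eta(8\tau)^{38}}{\eta(4\tau)^{14}\eta(16\tau)^{14}}=q+14q^5+81q^9+238q^{13}+O(q^{17})$. *)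

(* Defs.v *)
From mathcomp Require Import all_boot all_order all_algebra.

Set Implicit Arguments.
Unset Strict Implicit.
Unset Printing Implicit Defensive.

Import GRing.Theory.
Local Open Scope ring_scope.

Section LegendreFamily.

Variable F : finFieldType.

(* The two components of the pair are the coordinates x and y. *)
Definition leg_affine_points (l : F) : {set F * F} :=
  [set P : F * F | P.2 ^+ 2 == P.1 * (P.1 - 1) * (P.1 - l)].

(* The successor accounts for the single point at infinity. *)
Definition leg_card (l : F) : nat := #|leg_affine_points l|.+1.

Definition leg_tr (l : F) : int := #|F|%:Z + 1 - (leg_card l)%:Z.

Definition S_Leg (k : nat) : int := \sum_(l : F) leg_tr l ^+ k.

End LegendreFamily.

(* Meaningful for an odd prime p. *)
Definition legendre_symbol (a : int) (p : nat) : int :=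
  if (p %| a)%Z then 0
  else if [exists x : 'I_p, ((x : nat)%:Z ^+ 2 == a %[mod p])%Z] then 1
  else -1.

(* Meaningful for odd n > 0; prime_decomp lists the pairs (prime, exponent). *)
Definition jacobi_symbol (a : int) (n : nat) : int :=
  \prod_(f <- prime_decomp n) legendre_symbol a f.1 ^+ f.2.

(* Integral power series in q are handled through polynomials that represent  *)
(* them modulo q^(N+1), with 'X in the role of q.                             *)

(* \prod_(m >= 1) (1 - q^(d m)) modulo q^(N+1), for d > 0. Thus eta(d tau) is *)
(* q^(d/24) times this product.                                               *)
Definition euler_trunc (d N : nat) : {poly int} :=
  \prod_(1 <= m < N.+1) (1 - 'X^(d * m)).

(* Inverse modulo q^(N+1) of a series with constant term 1.                   *)
Definition inv_trunc (N : nat) (P : {poly int}) : {poly int} :=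
  \sum_(k < N.+1) (1 - P) ^+ k.

(* eta(8 tau)^38 / (eta(4 tau)^14 eta(16 tau)^14) modulo q^(N+1). The leading *)
(* factor 'X comes from (8 * 38 - 4 * 14 - 16 * 14) / 24 = 1.                 *)
Definition g2_trunc (N : nat) : {poly int} :=
  'X * euler_trunc 8 N ^+ 38 * inv_trunc N (euler_trunc 4 N) ^+ 14
                             * inv_trunc N (euler_trunc 16 N) ^+ 14.

Definition c_g2 (n : nat) : int := (g2_trunc n)`_n.

(* The lemmas below establish that c_g2 is the coefficient sequence of the    *)
(* full power series: see c_g2_trunc and c_g2_eta_quotient.                   *)

Definition eqX (N : nat) (P Q : {poly int}) :=
  forall i, (i <= N)%N -> P`_i = Q`_i.

Lemma eqX_refl N P : eqX N P P.
Proof. by []. Qed.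

Lemma eqX_sym N P Q : eqX N P Q -> eqX N Q P.
Proof. by move=> h i /h. Qed.

Lemma eqX_trans N P Q R : eqX N P Q -> eqX N Q R -> eqX N P R.
Proof. by move=> h1 h2 i le_iN; rewrite h1 ?h2. Qed.

Lemma eqX_mul N P P' Q Q' : eqX N P P' -> eqX N Q Q' -> eqX N (P * Q) (P' * Q').
Proof.
move=> hP hQ i le_iN; rewrite !coefM; apply: eq_bigr => j _.
rewrite hP ?hQ //; first exact: leq_trans (leq_subr _ _) le_iN.
by apply: leq_trans le_iN; rewrite -ltnS.
Qed.

Lemma eqX_exp N P Q k : eqX N P Q -> eqX N (P ^+ k) (Q ^+ k).
Proof.
move=> h; elim: k => [|k IHk]; first by rewrite !expr0.
by rewrite !exprS; apply: eqX_mul.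
Qed.

Lemma eqX_leq M N P Q : (M <= N)%N -> eqX N P Q -> eqX M P Q.
Proof. by move=> le_MN h i le_iM; apply/h/(leq_trans le_iM). Qed.

Lemma euler_trunc_stable d n N :
  (0 < d)%N -> (n <= N)%N -> eqX n (euler_trunc d n) (euler_trunc d N).
Proof.
move=> d_gt0 le_nN; rewrite /euler_trunc (@big_cat_nat _ _ _ n.+1 1 N.+1) //=.
rewrite -[X in eqX n X _]mulr1; apply: eqX_mul => //; apply: eqX_sym.
rewrite big_nat; apply: (big_ind (fun P => eqX n P 1)) => //.
  by move=> P Q hP hQ; rewrite -[X in eqX n _ X]mulr1; apply: eqX_mul.
move=> m /andP[lt_nm _] i le_in; rewrite coefB coefXn.
suff /negPf-> : i != (d * m)%N by rewrite subr0.
rewrite neq_ltn; apply/orP; left; apply: leq_ltn_trans le_in _.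
by apply: leq_trans lt_nm _; rewrite leq_pmull.
Qed.

Lemma euler_trunc0 d N : (0 < d)%N -> (euler_trunc d N)`_0 = 1.
Proof.
move=> d_gt0; rewrite -(euler_trunc_stable d_gt0 (leq0n N)) //.
by rewrite /euler_trunc big_geq // coef1.
Qed.

Lemma inv_truncP N (P : {poly int}) : P`_0 = 1 -> eqX N (P * inv_trunc N P) 1.
Proof.
move=> P0 i le_iN.
have -> : P * inv_trunc N P = 1 - (1 - P) ^+ N.+1.
  by rewrite -[RHS]opprB subrX1 -mulNr opprB opprB addrC subrK.
have -> : 1 - P = drop_poly 1 (1 - P) * 'X.
  rewrite -[LHS](poly_take_drop 1) expr1.
  suff -> : take_poly 1 (1 - P) = 0 by rewrite add0r.
  apply/polyP=> j; rewrite coef_take_poly coef0.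
  by case: j => [|j] //=; rewrite coefB coef1 P0 subrr.
by rewrite exprMn coefB coefMXn ltnS le_iN subr0.
Qed.

Lemma inv_trunc_stable n N (P Q : {poly int}) : (n <= N)%N -> P`_0 = 1 -> Q`_0 = 1 ->
  eqX n P Q -> eqX n (inv_trunc n P) (inv_trunc N Q).
Proof.
move=> le_nN P0 Q0 hPQ.
have hQ := eqX_leq le_nN (@inv_truncP N _ Q0).
apply: (@eqX_trans _ _ (inv_trunc n P * (Q * inv_trunc N Q))).
  by rewrite -[X in eqX n X _]mulr1; apply: eqX_mul => //; apply: eqX_sym.
rewrite mulrA -[X in eqX n _ X]mul1r; apply: eqX_mul => //.
apply: eqX_trans (@inv_truncP n _ P0); rewrite mulrC.
by apply: eqX_mul => //; apply: eqX_sym.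
Qed.

Lemma c_g2_trunc n N : (n <= N)%N -> c_g2 n = (g2_trunc N)`_n.
Proof.
move=> le_nN; suff: eqX n (g2_trunc n) (g2_trunc N) by apply.
have hE d : (0 < d)%N -> eqX n (euler_trunc d n) (euler_trunc d N).
  by move=> d_gt0; apply: euler_trunc_stable.
have hI d : (0 < d)%N ->
    eqX n (inv_trunc n (euler_trunc d n)) (inv_trunc N (euler_trunc d N)).
  by move=> d_gt0; apply: inv_trunc_stable (hE _ d_gt0); rewrite ?euler_trunc0.
rewrite /g2_trunc; apply: eqX_mul; last exact/eqX_exp/hI.
apply: eqX_mul; last exact/eqX_exp/hI.
by apply: eqX_mul => //; apply/eqX_exp/hE.
Qed.

Lemma c_g2_eta_quotient N :
  eqX N ((\poly_(n < N.+1) c_g2 n) * euler_trunc 4 N ^+ 14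
                                   * euler_trunc 16 N ^+ 14)
        ('X * euler_trunc 8 N ^+ 38).
Proof.
have hG : eqX N (\poly_(n < N.+1) c_g2 n) (g2_trunc N).
  by move=> i le_iN; rewrite coef_poly ltnS le_iN; apply: c_g2_trunc.
have h4 : eqX N ((euler_trunc 4 N * inv_trunc N (euler_trunc 4 N)) ^+ 14) 1.
  by rewrite -[X in eqX N _ X](expr1n _ 14);
     apply/eqX_exp/inv_truncP/euler_trunc0.
have h16 : eqX N ((euler_trunc 16 N * inv_trunc N (euler_trunc 16 N)) ^+ 14) 1.
  by rewrite -[X in eqX N _ X](expr1n _ 14);
     apply/eqX_exp/inv_truncP/euler_trunc0.
apply: (@eqX_trans _ _ (g2_trunc N * euler_trunc 4 N ^+ 14
                                   * euler_trunc 16 N ^+ 14)).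
  by apply: eqX_mul => //; apply: eqX_mul.
apply: (@eqX_trans _ _ ('X * euler_trunc 8 N ^+ 38 * 1 * 1)); last first.
  by rewrite !mulr1.
have -> : g2_trunc N * euler_trunc 4 N ^+ 14 * euler_trunc 16 N ^+ 14 =
    'X * euler_trunc 8 N ^+ 38
    * (euler_trunc 4 N * inv_trunc N (euler_trunc 4 N)) ^+ 14
    * (euler_trunc 16 N * inv_trunc N (euler_trunc 16 N)) ^+ 14.
  have reorder (a b c d e : {poly int}) :
      a * b * c * d * e = a * (d * b) * (e * c).
    by rewrite !mulrA (mulrAC a d b) (mulrAC (a * b * d) e c)
               (mulrAC (a * b) d c).
  by rewrite /g2_trunc !exprMn; apply: reorder.
by apply: eqX_mul => //; apply: eqX_mul.
Qed.

(* The value c_g2(p^(-1)), which occurs for r = 1, is 0 by convention. *)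
Definition c_g2_pow_sub2 (p r : nat) : int :=
  if (r < 2)%N then 0 else c_g2 (p ^ (r - 2)).

Definition E3 (p r : nat) : int :=
  - jacobi_symbol 2 (p ^ r)
  * (c_g2 (p ^ r) - jacobi_symbol (-1) p * p%:Z ^+ 4 * c_g2_pow_sub2 p r).

(* Main.v *)
(* Write phi for the quadratic character of F and q = #|F|, with q = 1 mod 4 (for
   q = 3 mod 4 the symmetry l -> 1 - l negates the trace).

   Point count. Expanding the cube of sum_x phi(x (x - a) (x - b)), weighted by
   phi(a - b), over pairs (a, b) of points of P^1 gives, for each triple x, y, z,
   a sum over (a, b) which is equivariant under GL_2, hence proportional to
   phi((x - y) (y - z) (z - x)). This yields S_3 = 2 q^2 - 4 q - S2^2, where S2 is
   the Selberg-type sum of phi(x y (1 - x) (1 - y) (x - y)). A quadratic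
   substitution turns S2 into A^2 - 2 q for the Jacobsthal sum
   A = sum_x phi(x^3 - x), and A^2 + B^2 = 4 q for its quadratic twist B. With
   A = c + d and B = c - d one gets c^2 + d^2 = 2 q and S2 = 2 c d.

   Eta quotient. By the triple product, the eta quotient (after q^4 -> - q^4) is a
   quotient of Jacobi's series for eta^3 and Gauss's series psi of triangular
   numbers. The identity 2 J^4 = psi^2 (3 psi_2^2 - psi_4 psi) between theta series
   comes from the odd vectors of Z^4 of given norm whose coordinates sum to 2 mod 4:
   they are stable under the 4 x 4 Hadamard reflection, which turns 16 x y z w into
   x^4 + y^4 + z^4 + w^4 - 2 (x^2 y^2 + .. + z^2 w^2) + 8 x y z w, so the sums of
   these two quartic forms agree. Hence 2 c_g2 (4 m + 1) is, up to the sign (-1)^m,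
   the sum of 3 x^2 y^2 - x^4 over odd x, y > 0 with x^2 + y^2 = 8 m + 2.

   For 4 m + 1 = p^r the pairs with p | x account for p^4 c_g2 (p^(r - 2)); if
   p = 1 mod 4 the others are only (c, d) and (d, c), as p does not divide A. *)

Require Import Defs.
From mathcomp Require Import all_boot all_order all_algebra all_field.
From mathcomp Require Import zify ring.

Set Implicit Arguments.
Unset Strict Implicit.
Unset Printing Implicit Defensive.
Import GRing.Theory Num.Theory.
Local Open Scope ring_scope.

(** * The quadratic character of a finite field *)

Section QuadraticCharacter.

Variable F : finFieldType.
Implicit Types x y z : F.

(** Euler's criterion serves as the definition, so that multiplicativity and the reduction to a
    power of x come at once; [sqrt_card] recovers the link with squares. *)
Definition qchar x : int :=
  if x == 0 then 0 else if x ^+ (#|F|.-1./2) == 1 then 1 else -1.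

Lemma qchar0 : qchar 0 = 0.
Proof. by rewrite /qchar eqxx. Qed.

Lemma qchar1 : qchar 1 = 1.
Proof. by rewrite /qchar oner_eq0 expr1n eqxx. Qed.

Lemma sqr_qchar x : qchar x ^+ 2 = (x != 0)%:R.
Proof. by rewrite /qchar; case: ifP => // _; case: ifP. Qed.

Lemma qchar_cube x : qchar x ^+ 3 = qchar x.
Proof. by rewrite /qchar; case: ifP => // _; case: ifP. Qed.

Lemma sum_const_neq0 (a : int) : \sum_(x : F | x != 0) a = (#|F|%:R - 1) * a.
Proof.
rewrite sumr_const cardC1 -subn1 -[LHS]mulr_natl natrB //.
by rewrite ltnW ?finNzRing_gt1.
Qed.

(** The translation x -> x + 1 permutes F, so it leaves the sum of all elements unchanged. *)
Lemma card_finField_eq0 : #|F|%:R = 0 :> F.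
Proof.
have /eqP : \sum_(x : F) (x + 1) = \sum_(x : F) x.
  by rewrite [RHS](reindex_inj (addIr 1)).
rewrite big_split /= -[X in _ == X]addr0 (inj_eq (addrI _)) sumr_const.
by move/eqP.
Qed.

Hypothesis oddF : odd #|F|.

Let m := #|F|.-1./2.

Lemma card_odd_finField : #|F| = m.*2.+1.
Proof. by rewrite /m; have := finNzRing_gt1 F; lia. Qed.

Lemma exp_half_card x : x != 0 -> x ^+ m = 1 \/ x ^+ m = -1.
Proof.
move=> x0; have : x ^+ m ^+ 2 = 1.
  have := expf_card x; rewrite {1}card_odd_finField exprS => /(canRL (mulKf x0)).
  by rewrite mulVf // -exprM muln2.
by move/eqP; rewrite sqrf_eq1 => /orP [] /eqP; [left | right].
Qed.

Lemma two_neq0 : 2%:R != 0 :> F.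
Proof.
apply/eqP => two0; have /eqP := card_finField_eq0.
by rewrite card_odd_finField -muln2 -natr1 natrM two0 mulr0 add0r oner_eq0.
Qed.

Lemma oner_neqN1 : (1 : F) != -1.
Proof. by rewrite -subr_eq0 opprK -mulr2n two_neq0. Qed.

Lemma qchar_intr x : (qchar x)%:~R = x ^+ m.
Proof.
rewrite /qchar; have [->|x0] := eqVneq x 0.
  rewrite expr0n; case: (m =P 0)%N => // m0.
  by have := finNzRing_gt1 F; rewrite card_odd_finField m0.
by rewrite -/m; case: (exp_half_card x0) => ->; rewrite ?eqxx //
   [_ == 1]eq_sym (negPf oner_neqN1).
Qed.

Lemma qcharM x y : qchar (x * y) = qchar x * qchar y.
Proof.
rewrite /qchar mulf_eq0; case: eqP => [_|/eqP x0]; first by rewrite mul0r.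
case: eqP => [_|/eqP y0]; first by rewrite mulr0.
rewrite /= -/m exprMn; have N1 := negPf oner_neqN1.
by case: (exp_half_card x0) => ->; case: (exp_half_card y0) => ->;
  rewrite ?(mulr1, mul1r, mulrNN, eqxx) // [_ == 1]eq_sym N1 ?mulr1 ?mulrNN.
Qed.

Lemma qchar_sqr x : x != 0 -> qchar (x ^+ 2) = 1.
Proof. by move=> x0; rewrite expr2 qcharM -expr2 sqr_qchar x0. Qed.

(** Squaring is two-to-one on nonzero elements, so there are [m] nonzero squares. All are roots of
    X^m - 1, which has at most [m] roots, hence they are exactly its roots. *)
Lemma sqrt_card x : (#|[set y : F | y ^+ 2 == x]|%:Z = 1 + qchar x)%R.
Proof.
have [->|x0] := eqVneq x 0.
  rewrite qchar0 addr0 (_ : [set _ | _] = [set 0]) ?cards1 //.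
  by apply/setP => y; rewrite !inE sqrf_eq0.
have m_gt0 : (0 < m)%N by have := finNzRing_gt1 F; rewrite card_odd_finField; lia.
have card2 (y : F) : y != 0 -> #|[set z : F | z ^+ 2 == y ^+ 2]| = 2%N.
  move=> y0; rewrite (_ : [set _ | _] = [set y; -y]).
    rewrite cards2 -subr_eq0 opprK -mulr2n -mulr_natr mulf_eq0.
    by rewrite (negPf y0) (negPf two_neq0).
  by apply/setP => z; rewrite !inE eqf_sqr.
pose S := [set y ^+ 2 | y in [set y : F | y != 0]].
pose T := [set y : F | (y != 0) && (y ^+ m == 1)].
have sST : S \subset T.
  apply/subsetP => _ /imsetP [y y0 ->]; rewrite !inE in y0 *.
  rewrite sqrf_eq0 y0 -exprM mul2n; apply/eqP/(mulIf y0).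
  by rewrite mul1r -exprSr -card_odd_finField expf_card.
have cS : #|S| = m.
  suff : (#|[set y : F | y != 0%R]| = \sum_(x in S) 2)%N.
    rewrite sum_nat_const; rewrite (_ : [set y : F | _] = ~: [set 0]).
      by rewrite cardsC1 card_odd_finField /= -muln2 => /eqP; rewrite eqn_mul2r => /eqP.
    by apply/setP => y; rewrite !inE.
  rewrite -sum1_card (partition_big_imset (fun y : F => y ^+ 2)) /=.
  apply: eq_bigr => _ /imsetP [y y0 ->]; rewrite !inE in y0.
  rewrite -[RHS](card2 _ y0) -sum1_card; apply: eq_bigl => z.
  rewrite !inE; have [e|_] := eqVneq (z ^+ 2) (y ^+ 2); rewrite ?andbF // andbT.
  by rewrite -sqrf_eq0 e sqrf_eq0.
have cT : (#|T| <= m)%N.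
  have -> : m = (size ('X^m - 1 : {poly F})).-1 by rewrite size_XnsubC.
  rewrite cardE; have P0 : ('X^m - 1 : {poly F}) != 0.
    by rewrite -size_poly_eq0 size_XnsubC.
  rewrite -ltnS prednK; last by rewrite lt0n size_poly_eq0.
  apply: max_poly_roots => //; last exact: enum_uniq.
  apply/allP => y; rewrite mem_enum inE => /andP [_ ym].
  by rewrite rootE !hornerE (eqP ym) subrr.
have eST : S = T by apply/eqP; rewrite eqEcard sST cS.
have [xm|xm] := boolP (x ^+ m == 1).
  have : x \in S by rewrite eST inE x0.
  case/imsetP => y; rewrite inE => y0 ex; rewrite {1}ex card2 //.
  by rewrite ex qchar_sqr.
rewrite /qchar (negPf x0) (negPf xm) subrr.
rewrite (_ : [set _ | _] = set0) ?cards0 //; apply/setP => y; rewrite !inE.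
apply/negP => /eqP ey; case/negP: xm.
have : x \in S.
  apply/imsetP; exists y => //; rewrite inE; apply: contraNneq x0 => y0.
  by rewrite -ey y0 expr0n.
by rewrite eST inE => /andP [].
Qed.

Lemma sum_sqr (f : F -> int) : \sum_y f (y ^+ 2) = \sum_x (1 + qchar x) * f x.
Proof.
rewrite (partition_big (fun y : F => y ^+ 2) xpredT) //=.
apply: eq_bigr => x _; rewrite -sqrt_card -sum1_card.
rewrite -[X in X * _]natz natr_sum mulr_suml.
by apply: eq_big => [y|y /eqP ->]; rewrite ?inE ?mul1r.
Qed.

Lemma sum_qchar : \sum_x qchar x = 0.
Proof.
have := sum_sqr (fun=> 1); under [RHS]eq_bigr do rewrite mulr1.
by rewrite big_split /= -{1}[LHS]addr0 => /addrI.
Qed.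

Lemma qchar_nonsquare : exists2 g : F, g != 0 & qchar g = -1.
Proof.
have [/existsP [g /andP [g0 /eqP hg]]|] :=
  boolP [exists g : F, (g != 0) && (qchar g == -1)]; first by exists g.
move/existsPn => h; exfalso; have := sum_qchar.
rewrite (bigD1 0) //= qchar0 add0r (eq_bigr (fun=> 1)) => [|x x0].
  by rewrite sumr_const cardC1 card_odd_finField; have := finNzRing_gt1 F;
     rewrite card_odd_finField; lia.
by have := h x; rewrite x0 /= /qchar (negPf x0); case: ifP.
Qed.

Lemma sum_qchar_shift a : \sum_x qchar (x - a) = 0.
Proof. by rewrite -[RHS]sum_qchar [RHS](reindex_inj (addIr (- a))). Qed.

Lemma sum_sqr_qchar : \sum_x qchar x ^+ 2 = #|F|%:R - 1.
Proof.
rewrite (bigD1 0) //= qchar0 expr0n add0r.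
rewrite (eq_bigr (fun=> 1)) => [|x x0]; last by rewrite sqr_qchar x0.
by rewrite sumr_const cardC1 -subn1 natrB // ltnW ?finNzRing_gt1.
Qed.

(** For distinct roots, with a moved to 0, the inversion x -> (b - a) / x makes the quadratic linear
    up to a square factor. The full linear sum vanishes, and only its term at 0, equal to 1, is
    missing. *)
Lemma sum_qchar_quadratic a b :
  \sum_x qchar ((x - a) * (x - b)) = if a == b then #|F|%:R - 1 else -1.
Proof.
have [<-|nab] := eqVneq a b.
  rewrite -sum_sqr_qchar [RHS](reindex_inj (addIr (- a))).
  by apply: eq_bigr => x _; rewrite qcharM -expr2.
have c0 : b - a != 0 by rewrite subr_eq0 eq_sym.
rewrite (reindex_inj (addIr a)) (bigD1 0) //= add0r subrr mul0r qchar0 add0r.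
have inj : injective (fun x => (b - a) / x).
  by move=> x y /(mulfI c0)/invr_inj.
have := sum_qchar_shift 1; rewrite (bigD1 0) //= sub0r => /eqP.
rewrite addr_eq0 => /eqP h; have := congr1 -%R h; rewrite opprK => {}h.
transitivity (\sum_(x | x != 0) qchar (- (x - 1))).
  rewrite (reindex_inj inj) /=; apply: eq_big => x.
    by rewrite mulf_eq0 (negPf c0) invr_eq0.
  rewrite mulf_eq0 (negPf c0) invr_eq0 /= => x0.
  have e : ((b - a) / x) ^+ 2 * - (x - 1) =
    ((b - a) / x + a - a) * ((b - a) / x + a - b) by field.
  by rewrite -e qcharM qchar_sqr ?mul1r // mulf_neq0 ?invr_eq0.
rewrite (eq_bigr (fun x => qchar (-1) * qchar (x - 1))) => [|x _]; last first.
  by rewrite -qcharM mulN1r.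
by rewrite -mulr_sumr -h mulrN -expr2 sqr_qchar oppr_eq0 oner_eq0.
Qed.

Lemma leg_trE l : leg_tr l = - \sum_x qchar (x * (x - 1) * (x - l)).
Proof.
rewrite /leg_tr /leg_card -[#|_|.+1]addn1 PoszD.
have -> : #|leg_affine_points l|%:Z = \sum_x (1 + qchar (x * (x - 1) * (x - l))).
  under eq_bigr do rewrite -sqrt_card.
  rewrite -[LHS]natz -sum1_card natr_sum.
  rewrite (partition_big (fun P : F * F => P.1) xpredT) //=.
  apply: eq_bigr => x _.
  rewrite -[RHS]natz -sum1_card natr_sum (reindex (fun y : F => (x, y))) /=.
    by apply: eq_bigl => y; rewrite !inE /= eqxx andbT.
  by exists snd => // [[u v]]; rewrite inE /= => /andP [_ /eqP ->].
rewrite big_split /= sumr_const natz; ring.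
Qed.

Lemma qcharN1 : qchar (-1) = if odd m then -1 else 1.
Proof.
have N0 : (-1 : F) != 0 by rewrite oppr_eq0 oner_eq0.
rewrite /qchar (negPf N0) -/m -signr_odd; case: (odd m); last by rewrite expr0 eqxx.
by rewrite expr1 [_ == 1]eq_sym (negPf oner_neqN1).
Qed.

End QuadraticCharacter.

(** * The third moment of the Legendre family *)

Section ThirdMoment.

Variable F : finFieldType.
Hypothesis oddF : odd #|F|.
Hypothesis N1 : qchar (-1 : F) = 1.
Implicit Types x y z : F.

Notation q := (#|F|%:R : int).

Lemma qcharN x : qchar (- x) = qchar x.
Proof. by rewrite -mulN1r qcharM // N1 mul1r. Qed.

Lemma qcharMsq x y : y != 0 -> qchar (y ^+ 2 * x) = qchar x.
Proof. by move=> y0; rewrite qcharM // qchar_sqr // mul1r. Qed.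

(** Such a g is constant on each punctured line through the origin, and the points (s, 1) and (1, 0)
    represent the lines. *)
Lemma sum_projective (g : F -> F -> int) :
  (forall c s t, c != 0 -> g (c * s) (c * t) = g s t) -> g 0 0 = 0 ->
  \sum_s \sum_t g s t = (q - 1) * (\sum_s g s 1 + g 1 0).
Proof.
move=> hg g0; rewrite exchange_big (bigD1 0) //= (bigD1 0) //= g0 add0r.
rewrite (eq_bigr (fun=> g 1 0)) => [|s s0]; last first.
  by rewrite -(hg s 1 0) // mulr1 mulr0.
rewrite [X in _ + X](eq_bigr (fun=> \sum_s g s 1)) => [|t t0]; last first.
  rewrite (reindex_inj (mulfI t0)) /=; apply: eq_bigr => s _.
  by rewrite -[in RHS](hg t) // mulr1.
by rewrite !sum_const_neq0 mulrDr addrC.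
Qed.

(** A pair (s, t) stands for the point s/t of P^1: [bracket] is a determinant, and [vanish x] is the
    homogenized difference of x and the point. *)
Definition bracket (a b : F * F) := a.1 * b.2 - a.2 * b.1.
Definition vanish x (a : F * F) := x * a.2 - a.1.

(** Coefficient of [qchar (x * y * z)] when [qchar (bracket a b) * pencil a b ^+ 3] is expanded and
    summed over all a and b. *)
Definition Psi x y z := \sum_(u : (F * F) * (F * F))
  qchar (bracket u.1 u.2 * (vanish x u.1 * vanish y u.1 * vanish z u.1)
                         * (vanish x u.2 * vanish y u.2 * vanish z u.2)).

(** Normal form of [Psi], the zeros of the three linear forms being moved to 0, infinity and -1. *)
Definition Psi0 := \sum_(u : (F * F) * (F * F))
  qchar (bracket u.1 u.2 * (u.1.1 * u.1.2 * (u.1.1 + u.1.2))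
                         * (u.2.1 * u.2.2 * (u.2.1 + u.2.2))).

Lemma reindex_plane (h : F * F -> F * F) (G : (F * F) * (F * F) -> int) :
  injective h -> \sum_u G u = \sum_u G (h u.1, h u.2).
Proof.
move=> hi; rewrite (reindex_inj (h := fun u => (h u.1, h u.2))) //.
by move=> [a b] [c d] /= [] /hi -> /hi ->.
Qed.

(** Put D = (x - y) (y - z) (z - x). The linear map [h] has determinant D and turns the three forms
    into multiples of a.1, a.2 and a.1 + a.2, with D^2 as product of the multipliers. The bracket
    thus contributes D and the two vectors the square D^4. *)
Lemma Psi_distinct x y z : x != y -> y != z -> z != x ->
  Psi x y z = qchar ((x - y) * (y - z) * (z - x)) * Psi0.
Proof.
rewrite -subr_eq0 => xy; rewrite -subr_eq0 => yz; rewrite -subr_eq0 => zx.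
pose h (a : F * F) := (y * (x - z) * a.1 - x * (z - y) * a.2,
                       (x - z) * a.1 - (z - y) * a.2).
have hx a : vanish x (h a) = (x - z) * (x - y) * a.1 by rewrite /vanish /=; ring.
have hy a : vanish y (h a) = (x - y) * (z - y) * a.2 by rewrite /vanish /=; ring.
have hz a : vanish z (h a) = (x - z) * (z - y) * (a.1 + a.2).
  by rewrite /vanish /=; ring.
have xz : x - z != 0 by rewrite -opprB oppr_eq0.
have zy : z - y != 0 by rewrite -opprB oppr_eq0.
rewrite /Psi (reindex_plane (h := h)) /=; last first.
  move=> a b e.
  have := hx a; have := hy a; rewrite e hx hy.
  move=> /(mulfI (mulf_neq0 xy zy)) e2 /(mulfI (mulf_neq0 xz xy)) e1.
  by rewrite [a]surjective_pairing -e1 -e2 -surjective_pairing.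
rewrite /Psi0 mulr_sumr; apply: eq_bigr => -[a b] _ /=.
rewrite !hx !hy !hz -qcharM //.
rewrite -[RHS](@qcharMsq _ (((x - y) * (y - z) * (z - x)) ^+ 2)); last first.
  by rewrite expf_neq0 // !mulf_neq0.
by congr qchar; rewrite /bracket /=; ring.
Qed.

(** Scaling the second coordinates by a nonsquare permutes the vectors but negates the sum. *)
Lemma sum_scaling0 (G : (F * F) * (F * F) -> int) :
  (forall c u, c != 0 -> G ((u.1.1, c * u.1.2), (u.2.1, c * u.2.2)) = qchar c * G u) ->
  \sum_u G u = 0.
Proof.
have [g g0 hg] := qchar_nonsquare oddF => hG.
pose h (a : F * F) := (a.1, g * a.2).
have hi : injective h by move=> -[a b] [c d] /= [-> /(mulfI g0) ->].
have : \sum_u G u = - \sum_u G u.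
  rewrite {1}(reindex_plane G hi) -sumrN.
  by apply: eq_bigr => -[a b] _; rewrite -[RHS]mulN1r -hg -hG.
by move/eqP; rewrite -addr_eq0 -mulr2n mulrn_eq0 /= => /eqP.
Qed.

(** In suitable coordinates the coincident forms are proportional to a.1. Scaling the second
    coordinates by c then multiplies the bracket by c and, if z differs from x, the third form at
    both vectors as well: an odd power of c in all. *)
Lemma Psi_xxz x z : Psi x x z = 0.
Proof.
have [<-|xz] := eqVneq x z.
  pose h (a : F * F) := (x * a.2 - a.1, a.2).
  rewrite /Psi (reindex_plane (h := h)) /=; last first.
    by move=> [a b] [c d] /= [e1 e2]; move: e1; rewrite e2 => /addrI/oppr_inj ->.
  apply: sum_scaling0 => c u c0; rewrite -qcharM //; congr qchar.
  by rewrite /bracket /vanish /=; ring.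
pose h (a : F * F) := (z * a.1 + x * a.2, a.1 + a.2).
rewrite /Psi (reindex_plane (h := h)) /=; last first.
  move=> [a b] [c d] /= [e1 e2].
  have e3 : (z - x) * a = (z - x) * c.
    transitivity ((z * a + x * b) - x * (a + b)); first by ring.
    by rewrite e1 e2; ring.
  have ac : a = c by apply: (mulfI _ e3); rewrite subr_eq0 eq_sym.
  by move: e2; rewrite ac => /addrI ->.
apply: sum_scaling0 => c u c0; rewrite -qcharM //.
rewrite -[RHS](@qcharMsq _ c) //; congr qchar.
by rewrite /bracket /vanish /=; ring.
Qed.

Lemma PsiE x y z : Psi x y z = qchar ((x - y) * (y - z) * (z - x)) * Psi0.
Proof.
have [->|xy] := eqVneq x y; first by rewrite Psi_xxz subrr !mul0r qchar0 mul0r.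
have [->|yz] := eqVneq y z.
  rewrite subrr mulr0 !mul0r qchar0 mul0r -[RHS](Psi_xxz z x).
  by apply: eq_bigr => u _; congr qchar; ring.
have [->|zx] := eqVneq z x; last exact: Psi_distinct.
rewrite subrr mulr0 qchar0 mul0r -[RHS](Psi_xxz x y).
by apply: eq_bigr => u _; congr qchar; ring.
Qed.

Definition S2 := \sum_(x : F) \sum_(y : F)
  qchar (x * y * (1 - x) * (1 - y) * (x - y)).

(** Both vectors are reduced to points of P^1. Infinity is a zero of the cubic form and drops out;
    negating the two affine coordinates gives [S2]. *)
Lemma Psi0E : Psi0 = (q - 1) ^+ 2 * S2.
Proof.
pose g (a b : F * F) : int :=
  qchar (bracket a b * (a.1 * a.2 * (a.1 + a.2)) * (b.1 * b.2 * (b.1 + b.2))).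
have sc c a b : c != 0 -> g (c * a.1, c * a.2) b = g a b.
  move=> c0; rewrite /g -[RHS](@qcharMsq _ (c ^+ 2)) ?expf_neq0 //.
  by congr qchar; rewrite /bracket /=; ring.
have sw a b : g a b = g b a.
  by rewrite /g -qcharN; congr qchar; rewrite /bracket /=; ring.
transitivity (\sum_a \sum_b g a b); first by rewrite pair_bigA.
have g0 b : g (1, 0) b = 0 by rewrite /g /= mulr0 mul0r mulr0 mul0r qchar0.
have g00 b : g (0, 0) b = 0 by rewrite /g /= mulr0 mul0r mulr0 mul0r qchar0.
have inner a : \sum_b g a b = (q - 1) * \sum_s g a (s, 1).
  transitivity (\sum_s \sum_t g a (s, t)).
    by rewrite pair_bigA; apply: eq_bigr => -[].
  rewrite sum_projective; first by rewrite (sw a) g0 addr0.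
    by move=> c s t c0; rewrite sw (sc c (s, t)) // sw.
  by rewrite sw g00.
rewrite (eq_bigr _ (fun a _ => inner a)) -mulr_sumr expr2 -mulrA; congr (_ * _).
rewrite exchange_big /=.
have outer s : \sum_a g a (s, 1) = (q - 1) * \sum_t g (t, 1) (s, 1).
  transitivity (\sum_t \sum_u g (t, u) (s, 1)).
    by rewrite pair_bigA; apply: eq_bigr => -[].
  rewrite (sum_projective (g := fun t u => g (t, u) (s, 1))) ?g0 ?addr0 ?g00 //.
  by move=> c t u c0; rewrite (sc c (t, u)).
rewrite (eq_bigr _ (fun s _ => outer s)) -mulr_sumr; congr (_ * _).
rewrite /S2 [RHS](reindex_inj oppr_inj); apply: eq_bigr => s _.
rewrite [RHS](reindex_inj oppr_inj); apply: eq_bigr => t _.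
by congr qchar; rewrite /bracket /=; ring.
Qed.

(** By [PsiE] there remains a sum over x, y, z of a homogeneous expression of degree 6. Scaling x
    and y by z removes z and leaves q - 1 copies of [S2]. *)
Lemma sum_Psi : \sum_x \sum_y \sum_z qchar (x * y * z) * Psi x y z =
  (q - 1) ^+ 3 * S2 ^+ 2.
Proof.
pose g x y z := qchar (x * y * z * ((x - y) * (y - z) * (z - x))).
transitivity ((\sum_z \sum_x \sum_y g x y z) * Psi0).
  rewrite [in RHS]exchange_big mulr_suml; apply: eq_bigr => x _.
  rewrite [in RHS]exchange_big mulr_suml; apply: eq_bigr => y _.
  by rewrite mulr_suml; apply: eq_bigr => z _; rewrite PsiE mulrA -qcharM.
have -> : \sum_z \sum_x \sum_y g x y z = (q - 1) * S2.
  rewrite (bigD1 0) //= big1 ?add0r => [|x _]; last first.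
    by rewrite big1 // => y _; rewrite /g mulr0 mul0r qchar0.
  rewrite (eq_bigr (fun=> S2)) => [|z z0].
    by rewrite sum_const_neq0.
  rewrite (reindex_inj (mulfI z0)); apply: eq_bigr => x _.
  rewrite (reindex_inj (mulfI z0)); apply: eq_bigr => y _.
  rewrite /g -[RHS](@qcharMsq _ (z ^+ 3)) ?expf_neq0 // -[RHS]qcharN.
  by congr qchar; ring.
by rewrite Psi0E; ring.
Qed.

Lemma leg_tr0 : leg_tr (0 : F) = 1.
Proof.
rewrite leg_trE // (bigD1 0) //= !mul0r qchar0 add0r.
have := sum_qchar_shift oddF 1; rewrite (bigD1 0) //= sub0r N1.
move/(canRL (addKr 1)); rewrite addr0 => e; rewrite -[RHS]opprK -e; congr (- _).
apply: eq_bigr => x x0; rewrite -[RHS](@qcharMsq _ x) //.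
by congr qchar; ring.
Qed.

Lemma leg_tr_refl (l : F) : @leg_tr F (1 - l) = leg_tr l.
Proof.
rewrite !leg_trE // (reindex_inj (h := fun x => 1 - x)); last first.
  by move=> x y /addrI/oppr_inj.
congr (- _); apply: eq_bigr => x _; rewrite -[RHS]qcharN; congr qchar; ring.
Qed.

Lemma leg_trV (l : F) : l != 0 -> @leg_tr F l^-1 = qchar l * leg_tr l.
Proof.
move=> l0; rewrite !leg_trE // mulrN; congr (- _).
rewrite (reindex_inj (mulIf (invr_neq0 l0))) mulr_sumr; apply: eq_bigr => x _.
rewrite -qcharM // -[RHS](@qcharMsq _ (l^-1 ^+ 2)) ?expf_neq0 ?invr_eq0 //.
by congr qchar; field.
Qed.

(** For l != 0 the product [qchar l * leg_tr l ^+ 3] is the cube of the trace at 1/l, since [qchar]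
    is its own cube. The substitution l -> 1 - l brings the weight into this form, and only the term
    1 of [S_Leg] at l = 0 is lost. *)
Lemma sum_twisted_cube : \sum_(l : F) qchar (1 - l) * leg_tr l ^+ 3 = S_Leg F 3 - 1.
Proof.
rewrite (reindex_inj (h := fun x => 1 - x)) /=; last by move=> x y /addrI/oppr_inj.
transitivity (\sum_(l : F | l != 0) @leg_tr F l^-1 ^+ 3).
  rewrite (bigD1 0) //= subr0 subrr qchar0 mul0r add0r; apply: eq_bigr => l l0.
  by rewrite leg_tr_refl leg_trV // opprB addrC subrK exprMn qchar_cube.
rewrite /S_Leg [in RHS](bigD1 0) //= leg_tr0 expr1n [1 + _]addrC addrK.
rewrite [RHS](reindex_inj invr_inj) /=.
by apply: eq_bigl => l; rewrite invr_eq0.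
Qed.

(** At affine points a and b this is minus the trace of y^2 = x (x - a) (x - b); the homogenized
    form also allows infinity. *)
Definition pencil (a b : F * F) := \sum_x qchar (x * vanish x a * vanish x b).

(** For t != 0 the scaling x -> t x turns the pair (t, t l) into the Legendre curve of l, and
    [qchar t] occurs to the fourth power; [sum_twisted_cube] then sums over l. For t = 0 the cubic
    is nodal and each s != 0 contributes -1. *)
Lemma pencil_affine : \sum_s \sum_t
    qchar (bracket (t, 1) (s, 1)) * pencil (t, 1) (s, 1) ^+ 3 =
  - (q - 1) * S_Leg F 3.
Proof.
rewrite exchange_big (bigD1 0) //= (bigD1 0) //=.
rewrite /bracket /= mul0r mulr0 subrr qchar0 mul0r add0r.
rewrite (eq_bigr (fun=> -1)) => [|s s0]; last first.
  have -> : pencil (0, 1) (s, 1) = - qchar s.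
    rewrite /pencil (bigD1 0) //= !mul0r qchar0 add0r.
    have := sum_qchar_shift oddF s; rewrite (bigD1 0) //= sub0r qcharN.
    move/(canRL (addKr _)); rewrite addr0 => <-; apply: eq_bigr => x x0.
    by rewrite -[RHS](@qcharMsq _ x) //; congr qchar; rewrite /vanish /=; ring.
  rewrite (_ : qchar _ = qchar s); last by rewrite -[RHS]qcharN; congr qchar; ring.
  by rewrite exprNn -signr_odd /= qchar_cube expr1 mulN1r mulrN -expr2 sqr_qchar s0.
rewrite [X in _ + X](eq_bigr (fun=> 1 - S_Leg F 3)) => [|t t0]; last first.
  rewrite -[RHS]opprB -sum_twisted_cube -sumrN (reindex_inj (mulfI t0)) /=.
  apply: eq_bigr => l _.
  have -> : pencil (t, 1) (t * l, 1) = - (qchar t * leg_tr l).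
    rewrite leg_trE // mulrN opprK mulr_sumr /pencil (reindex_inj (mulfI t0)).
    apply: eq_bigr => x _; rewrite -qcharM // -[RHS](@qcharMsq _ t) //.
    by congr qchar; rewrite /vanish /=; ring.
  rewrite (_ : t * 1 - _ = t * (1 - l)); last by ring.
  rewrite qcharM //.
  have : qchar t ^+ 4 = 1 by rewrite (exprM _ 2 2) sqr_qchar t0.
  move: (qchar t) (qchar (1 - l)) (leg_tr l) => u v w hu.
  transitivity (- (u ^+ 4 * (v * w ^+ 3))); first by ring.
  by rewrite hu mul1r.
by rewrite !sum_const_neq0; ring.
Qed.

Lemma cube_sum (f : F -> int) :
  (\sum_x f x) ^+ 3 = \sum_x \sum_y \sum_z f x * f y * f z.
Proof.
rewrite !exprSr expr0 mul1r !mulr_suml; apply: eq_bigr => x _.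
rewrite [f x * _]mulr_sumr mulr_suml; apply: eq_bigr => y _.
by rewrite mulr_sumr.
Qed.

(** The sum of [g] over all pairs of vectors is computed twice. Expanding the cube gives [sum_Psi].
    Projectivizing gives [pencil_affine] for the affine pairs, and (q - 1)^3 - (q - 1) twice for the
    pairs with one point at infinity. *)
Lemma third_moment : S_Leg F 3 = 2 * q ^+ 2 - 4 * q - S2 ^+ 2.
Proof.
pose g (a b : F * F) : int := qchar (bracket a b) * pencil a b ^+ 3.
have gE : \sum_x \sum_y \sum_z qchar (x * y * z) * Psi x y z = \sum_a \sum_b g a b.
  rewrite [RHS]pair_bigA /=.
  under eq_bigr => x _ do under eq_bigr => y _ do
    under eq_bigr => z _ do rewrite mulr_sumr.
  under eq_bigr => x _ do under eq_bigr => y _ do rewrite exchange_big.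
  under eq_bigr => x _ do rewrite exchange_big.
  rewrite exchange_big; apply: eq_bigr => -[a b] _ /=.
  rewrite /g cube_sum mulr_sumr; apply: eq_bigr => x _.
  rewrite mulr_sumr; apply: eq_bigr => y _.
  rewrite mulr_sumr; apply: eq_bigr => z _.
  by rewrite -!qcharM //; congr qchar; ring.
have sw a b : g a b = g b a.
  rewrite /g -qcharN; congr (qchar _ * _ ^+ 3); first by rewrite /bracket; ring.
  by apply: eq_bigr => x _; congr qchar; ring.
have sc c a b : c != 0 -> g (c * a.1, c * a.2) b = g a b.
  move=> c0; rewrite /g.
  have -> : pencil (c * a.1, c * a.2) b = qchar c * pencil a b.
    rewrite mulr_sumr; apply: eq_bigr => x _; rewrite -qcharM //; congr qchar.
    by rewrite /vanish /=; ring.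
  have -> : bracket (c * a.1, c * a.2) b = c * bracket a b by rewrite /bracket /=; ring.
  rewrite qcharM // exprMn qchar_cube mulrACA -expr2 sqr_qchar c0.
  by rewrite mul1r.
have g00 b : g (0, 0) b = 0 by rewrite /g /bracket /= !mul0r subrr qchar0 mul0r.
have inner a : \sum_b g a b = (q - 1) * (\sum_s g a (s, 1) + g a (1, 0)).
  transitivity (\sum_s \sum_t g a (s, t)).
    by rewrite pair_bigA; apply: eq_bigr => -[].
  rewrite sum_projective //; first by move=> c s t c0; rewrite sw (sc c (s, t)) // sw.
  by rewrite sw g00.
have outer b : \sum_a g a b = (q - 1) * (\sum_t g (t, 1) b + g (1, 0) b).
  rewrite -[X in _ * (_ + X)]sw; under [X in _ * (X + _)]eq_bigr do rewrite sw.
  by rewrite -inner; apply: eq_bigr => a _; rewrite sw.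
have g11 : g (1, 0) (1, 0) = 0.
  by rewrite /g /bracket /= mul0r mulr0 subrr qchar0 mul0r.
(* Against the point at infinity the cubic drops to the quadratic x (x - s), up to sign. *)
have g_inf s : g (1, 0) (s, 1) = if s == 0 then (q - 1) ^+ 3 else - 1.
  rewrite /g /bracket /= mulr1 mul0r subr0 qchar1 mul1r.
  have -> : pencil (1, 0) (s, 1) = if s == 0 then q - 1 else -1.
    rewrite eq_sym -(sum_qchar_quadratic oddF); apply: eq_bigr => x _.
    by rewrite -[RHS]qcharN; congr qchar; rewrite /vanish /=; ring.
  by case: ifP.
have sum_inf : \sum_s g (1, 0) (s, 1) = (q - 1) ^+ 3 - (q - 1).
  rewrite (bigD1 0) //= g_inf eqxx (eq_bigr (fun=> -1)) => [|s s0].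
    by rewrite sum_const_neq0 mulrN1.
  by rewrite g_inf (negPf s0).
have := sum_Psi; rewrite gE (eq_bigr _ (fun a _ => inner a)) -mulr_sumr big_split /=.
rewrite exchange_big /= (eq_bigr _ (fun s _ => outer (s, 1))) -mulr_sumr big_split /=.
rewrite pencil_affine outer g11 sum_inf addr0.
under eq_bigr do rewrite sw; rewrite sum_inf.
have q1 : q - 1 != 0.
  by rewrite subr_eq0 pnatr_eq1 gtn_eqF ?finNzRing_gt1.
move: q1 (S_Leg F 3) => + T e; move: (q) e => k e k1.
have k3 : (k - 1) ^+ 3 != 0 by rewrite expf_neq0.
apply: (mulfI k3);
transitivity (2 * ((k - 1) ^+ 3 * ((k - 1) ^+ 2 - 1)) - (k - 1) ^+ 3 * S2 ^+ 2);
  last by ring.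
by rewrite -e; ring.
Qed.

End ThirdMoment.

(** * Jacobsthal sums *)

(** Squares are 0 or 1 modulo 4, so A = 2 a and B = 2 b; then c = a + b and d = a - b. *)
Lemma even_of_sqrs (A B n : int) : A ^+ 2 + B ^+ 2 = 4 * n ->
  exists c d : int, [/\ A = c + d, B = c - d & c ^+ 2 + d ^+ 2 = 2 * n].
Proof.
have half (x : int) : exists y, x = 2 * y \/ x = 2 * y + 1.
  by exists (x %/ 2)%Z; lia.
have [a hA] := half A; have [b hB] := half B; move=> h.
exists (a + b), (a - b).
by case: hA hB h => -> [] ->; split; lia.
Qed.

Section JacobsthalSums.

Variable F : finFieldType.
Hypothesis oddF : odd #|F|.
Hypothesis N1 : qchar (-1 : F) = 1.
Implicit Types x y z : F.

Notation q := (#|F|%:R : int).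

(** The equation x + c / x = w is quadratic in x with discriminant w^2 - 4 c, and y = 2 x - w
    matches its roots with the square roots of the discriminant. *)
Lemma sum_joukowski (f : F -> int) (c : F) : c != 0 ->
  \sum_(x : F | x != 0) f (x + c / x) = \sum_w (1 + qchar (w ^+ 2 - 4 * c)) * f w.
Proof.
move=> c0; rewrite (partition_big (fun x => x + c / x) xpredT) //=.
apply: eq_bigr => w _; rewrite -sqrt_card // -[X in X * _]natz -sum1_card.
rewrite natr_sum mulr_suml.
rewrite (reindex (fun y : F => (y + w) / 2)) /=; last first.
  by exists (fun x : F => 2 * x - w) => x _; field; apply: two_neq0.
have F2 := two_neq0 oddF; have F4 : 4 != 0 :> F by rewrite (natrM _ 2 2) mulf_neq0.
have yE y : (y + w) / 2 != 0 ->
    y ^+ 2 - (w ^+ 2 - 4 * c) = 4 * ((y + w) / 2) * ((y + w) / 2 + c / ((y + w) / 2) - w).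
  by move=> h; field; rewrite F2 /=; move: h; rewrite mulf_eq0 negb_or => /andP[].
apply: eq_big => [y|y /andP [_ /eqP ->]]; last by rewrite mul1r.
rewrite inE; have [y0|y0] := eqVneq ((y + w) / 2) 0; last first.
  by rewrite /= -[in RHS]subr_eq0 yE // 2!mulf_eq0 (negPf F4) (negPf y0) subr_eq0.
have -> : y = - w.
  by move/eqP: y0; rewrite mulf_eq0 invr_eq0 (negPf F2) orbF addr_eq0 => /eqP.
rewrite sqrrN /= -[in RHS]subr_eq0 opprB [_ + (_ - _)]addrC subrK mulf_eq0.
by rewrite (negPf F4) (negPf c0).
Qed.

Definition jacobsthal (k : F) := \sum_x qchar (x ^+ 3 - k * x).

(** Common form of [S2] and of one part of the squared Jacobsthal sum; each is reached by
    [sum_joukowski]. *)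
Let W := \sum_(t : F | t != 0) \sum_(e : F)
  qchar (t * (e ^+ 2 - 1) * (t ^+ 2 + 1 - 2 * e * t)).

Lemma S2_W : S2 F = W.
Proof.
have F2 := two_neq0 oddF; have F4 : 4 != 0 :> F by rewrite (natrM _ 2 2) mulf_neq0.
rewrite /W exchange_big /=.
transitivity (\sum_(e : F) \sum_(w : F) qchar ((e ^+ 2 - 1) * (w ^+ 2 - 4) * (w - 2 * e))).
  rewrite /S2 exchange_big /=.
  rewrite [RHS](reindex_inj (h := fun e : F => 2 * e - 1)) /=; last first.
    by move=> x y /addIr/(mulfI F2).
  apply: eq_bigr => y _.
  rewrite [RHS](reindex_inj (h := fun w : F => 4 * w - 2)) /=; last first.
    by move=> x z /addIr/(mulfI F4).
  (* With e = 2 y - 1 and w = 4 x - 2 the three factors gain 4, 16 and 4, whose product is 16^2. *)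
  apply: eq_bigr => x _; rewrite -(@qcharMsq _ oddF _ (16 : F)).
    by congr qchar; ring.
  by rewrite (natrM _ 4 4) mulf_neq0.
apply: eq_bigr => e _.
transitivity (\sum_(t : F | t != 0) qchar ((e ^+ 2 - 1) * (t + 1 / t - 2 * e))).
  rewrite (sum_joukowski (fun w => qchar ((e ^+ 2 - 1) * (w - 2 * e)))) ?oner_neq0 //.
  under [RHS]eq_bigr do rewrite mulrDl mul1r.
  rewrite big_split /= [X in _ = X + _](_ : _ = 0) ?add0r.
    by apply: eq_bigr => w _; rewrite -qcharM //; congr qchar; ring.
  under eq_bigr do rewrite qcharM //; rewrite -mulr_sumr.
  by rewrite (sum_qchar_shift oddF) mulr0.
apply: eq_bigr => t t0; rewrite -[LHS](@qcharMsq _ oddF _ t) //; congr qchar.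
by field.
Qed.

(** Pairing x with x / t gives a sum over t of a function of x^2, and x^2 is replaced by u with
    weight 1 + [qchar u]. The part of weight 1 is a quadratic sum in u, where only t = 1 and t = -1
    survive and give 2 q. The other part becomes [W] through w = u + t^2 / u. *)
Lemma jacobsthal_sqr : jacobsthal 1 ^+ 2 = S2 F + 2 * q.
Proof.
have F2 := two_neq0 oddF.
transitivity (\sum_(t : F) \sum_(x : F) qchar (t * ((x ^+ 2 - 1) * (x ^+ 2 - t ^+ 2)))).
  rewrite exchange_big /= expr2 {1}/jacobsthal mulr_suml; apply: eq_bigr => x _.
  have [->|x0] := eqVneq x 0.
    rewrite expr0n /= mulr0 subr0 qchar0 mul0r.
    rewrite [RHS](eq_bigr (fun t : F => qchar t)) ?sum_qchar // => t _.
    have [->|t0] := eqVneq t 0; first by rewrite mul0r.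
    by rewrite -[RHS](@qcharMsq _ oddF _ t) //; congr qchar; ring.
  (* As the inverse of 0 is 0 by convention, t -> x / t permutes all of F. *)
  rewrite /jacobsthal (reindex_inj (h := fun t : F => x * t^-1)); last first.
    by move=> s t /(mulfI x0)/invr_inj.
  rewrite mulr_sumr; apply: eq_bigr => t _; rewrite -qcharM //.
  have [->|t0] := eqVneq t 0; first by rewrite invr0 !(mulr0, mul0r, expr0n, subr0).
  rewrite -[RHS](@qcharMsq _ oddF _ (x * t^-1 ^+ 2)); last first.
    by rewrite mulf_neq0 // expf_neq0 // invr_eq0.
  by congr qchar; field.
transitivity (\sum_(t : F) \sum_(u : F) (1 + qchar u) * qchar (t * ((u - 1) * (u - t ^+ 2)))).
  by apply: eq_bigr => t _; rewrite -sum_sqr.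
under eq_bigr => t _ do under eq_bigr do rewrite mulrDl mul1r.
under eq_bigr => t _ do rewrite big_split /=.
rewrite big_split /= addrC; congr (_ + _).
  rewrite S2_W /W (bigD1 0) //= big1 => [|u _]; last by rewrite mul0r qchar0 mulr0.
  rewrite add0r; apply: eq_bigr => t t0.
  transitivity (\sum_(u : F | u != 0) qchar (t * (u + t ^+ 2 / u - (1 + t ^+ 2)))).
    rewrite (bigD1 0) //= qchar0 mul0r add0r; apply: eq_bigr => u u0.
    rewrite -qcharM // -[RHS](@qcharMsq _ oddF _ u) //; congr qchar.
    by field.
  rewrite (sum_joukowski (fun w => qchar (t * (w - (1 + t ^+ 2))))) ?expf_neq0 //.
  under [LHS]eq_bigr do rewrite mulrDl mul1r.
  rewrite big_split /= [X in X + _](_ : _ = 0) ?add0r; last first.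
    under eq_bigr do rewrite qcharM //; rewrite -mulr_sumr.
    by rewrite (sum_qchar_shift oddF) mulr0.
  have t2 : 2 * t != 0 by rewrite mulf_neq0.
  rewrite (reindex_inj (mulfI t2)); apply: eq_bigr => e _.
  rewrite -qcharM // -[RHS](@qcharMsq _ oddF _ (2 * t)) // -[RHS]qcharN //.
  by congr qchar; ring.
under eq_bigr => t _ do under eq_bigr do rewrite qcharM //.
under eq_bigr => t _ do rewrite -mulr_sumr (sum_qchar_quadratic oddF).
rewrite (eq_bigr (fun t : F => (t ^+ 2 == 1)%:R * q - qchar t)).
  rewrite big_split /= sumrN sum_qchar // oppr0 addr0 -mulr_suml -natr_sum.
  have e : (#|[set t : F | t ^+ 2 == 1]|%:R : int) = 2.
    by rewrite natz sqrt_card // qchar1.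
  rewrite -e -sum1_card.
  by rewrite [in RHS]big_mkcond; congr (_%:R * _); apply: eq_bigr => t _; rewrite inE; case: ifP.
move=> t _; rewrite [1 == _]eq_sym; have [t1|_] := eqVneq (t ^+ 2) 1;
  last by rewrite /= mulrN1 mul0r sub0r.
have -> : qchar t = 1; last by rewrite !mul1r.
by move/eqP: t1; rewrite sqrf_eq1 => /orP [] /eqP ->; rewrite ?qchar1 ?N1.
Qed.

Lemma jacobsthal0 : jacobsthal 0 = 0.
Proof.
rewrite -[RHS](sum_qchar oddF); apply: eq_bigr => x _.
have [->|x0] := eqVneq x 0; first by rewrite expr0n mulr0 subr0.
by rewrite -[RHS](@qcharMsq _ oddF _ x) //; congr qchar; ring.
Qed.

Lemma jacobsthalM c k : c != 0 -> jacobsthal (c ^+ 2 * k) ^+ 2 = jacobsthal k ^+ 2.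
Proof.
move=> c0; suff -> : jacobsthal (c ^+ 2 * k) = qchar c * jacobsthal k.
  by rewrite exprMn sqr_qchar c0 mul1r.
rewrite mulr_sumr /jacobsthal (reindex_inj (mulfI c0)); apply: eq_bigr => x _.
rewrite -qcharM // -[RHS](@qcharMsq _ oddF _ c) //; congr qchar; ring.
Qed.

(** For fixed x and y the sum over k is a quadratic character sum with roots x^2 and y^2, so apart
    from a constant that cancels in the sum over y only y = x and y = -x count. *)
Lemma sum_jacobsthal_sqr : \sum_k jacobsthal k ^+ 2 = 2 * q * (q - 1).
Proof.
transitivity (\sum_(x : F) \sum_(y : F) qchar (x * y) * ((x ^+ 2 == y ^+ 2)%:R * q - 1)).
  under eq_bigr do rewrite expr2 mulr_suml.
  rewrite exchange_big /=; apply: eq_bigr => x _.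
  under eq_bigr do rewrite mulr_sumr.
  rewrite exchange_big /=; apply: eq_bigr => y _.
  transitivity (\sum_k qchar (x * y) * qchar ((k - x ^+ 2) * (k - y ^+ 2))).
    by apply: eq_bigr => k _; rewrite -!qcharM //; congr qchar; ring.
  rewrite -mulr_sumr sum_qchar_quadratic //; congr (_ * _).
  by case: eqP; rewrite ?mul1r ?mul0r ?sub0r.
rewrite (bigD1 0) //= big1 => [|y _]; last by rewrite mul0r qchar0 mul0r.
rewrite add0r (eq_bigr (fun=> 2 * q)) => [|x x0]; first by rewrite sum_const_neq0 mulrC.
transitivity (\sum_(y : F) qchar (x * y) * (x ^+ 2 == y ^+ 2)%:R * q
   - qchar x * \sum_(y : F) qchar y).
  rewrite mulr_sumr -sumrB; apply: eq_bigr => y _.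
  by rewrite mulrBr mulr1 mulrA [in RHS]qcharM // qcharM.
rewrite sum_qchar // mulr0 subr0 -mulr_suml; congr (_ * _).
have xNx : - x != x.
  by rewrite eq_sym -subr_eq0 opprK -mulr2n -mulr_natr mulf_neq0 // two_neq0.
rewrite (bigD1 x) //= (bigD1 (- x)) //= big1 => [|y /andP [yx yNx]].
  by rewrite mulrN qcharN // -expr2 qchar_sqr // sqrrN eqxx addr0.
by rewrite eqf_sqr eq_sym (negPf yx) -eqr_oppLR eq_sym (negPf yNx) mulr0.
Qed.

(** The squared sum depends only on the class of k modulo nonzero squares and vanishes at 0, so the
    second moment over all k determines the total of the two classes. *)
Lemma jacobsthal_sum_sqr g : qchar g = -1 ->
  jacobsthal 1 ^+ 2 + jacobsthal g ^+ 2 = 4 * q.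
Proof.
move=> hg; have g0 : g != 0 by apply/eqP => g0; rewrite g0 qchar0 in hg.
have q1 : q - 1 != 0.
  by rewrite subr_eq0 pnatr_eq1 gtn_eqF ?finNzRing_gt1.
pose f k := jacobsthal k ^+ 2.
have sf k : \sum_c f (c ^+ 2 * k) = (q - 1) * f k.
  rewrite (bigD1 0) //= expr0n mul0r {1}/f jacobsthal0 expr0n add0r.
  by rewrite -sum_const_neq0; apply: eq_bigr => c c0; apply: jacobsthalM.
have e1 : \sum_c f (c ^+ 2 * 1) = \sum_k (1 + qchar k) * f k.
  by rewrite -sum_sqr //; apply: eq_bigr => c _; rewrite mulr1.
have eg : \sum_c f (c ^+ 2 * g) = \sum_k (1 - qchar k) * f k.
  rewrite (sum_sqr oddF (fun c => f (c * g))) [RHS](reindex_inj (mulIf g0)).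
  by apply: eq_bigr => k _; rewrite qcharM // hg mulrN1 opprK.
apply: (mulfI q1); rewrite mulrDr -[LHS]/((q - 1) * f 1 + (q - 1) * f g).
rewrite -!sf e1 eg -big_split /=.
transitivity (2 * \sum_k f k).
  by rewrite mulr_sumr; apply: eq_bigr => k _; ring.
by rewrite sum_jacobsthal_sqr; ring.
Qed.

Lemma third_moment_sum_squares : exists c d : int,
  [/\ c ^+ 2 + d ^+ 2 = 2 * q, jacobsthal 1 = c + d &
      S_Leg F 3 = 2 * q ^+ 2 - 4 * q - 4 * c ^+ 2 * d ^+ 2].
Proof.
have [g g0 hg] := qchar_nonsquare oddF.
have := jacobsthal_sum_sqr hg; have := jacobsthal_sqr; rewrite third_moment //.
move: (jacobsthal 1) (jacobsthal g) (S2 F) => A B S hA /even_of_sqrs [c [d []]].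
move=> eA eB hAB; exists c, d.
have hS : S = 2 * c * d.
  transitivity (A ^+ 2 - 2 * q); first by rewrite hA; ring.
  by rewrite eA -hAB; ring.
by split=> //; rewrite hS; ring.
Qed.

End JacobsthalSums.

(** * Power sums and the Jacobsthal sum modulo p *)

Lemma sum_expr_small (F : finFieldType) k : (0 < k < #|F|.-1)%N -> \sum_(x : F) x ^+ k = 0.
Proof.
case/andP => k0 kq.
have [/existsP [c /andP [c0 ck]]|] := boolP [exists c : F, (c != 0) && (c ^+ k != 1)].
  apply/eqP; rewrite -(inj_eq (mulfI (_ : c ^+ k - 1 != 0))) ?subr_eq0 // mulr0.
  rewrite mulrBl mul1r subr_eq0 [X in _ == X](reindex_inj (mulfI c0)) mulr_sumr.
  by apply/eqP/eq_bigr => x _; rewrite exprMn.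
move/existsPn => h; exfalso; move: kq; rewrite ltnNge => /negP; apply.
have P0 : ('X^k - 1 : {poly F}) != 0 by rewrite -size_poly_eq0 size_XnsubC.
rewrite -ltnS -(size_XnsubC (1 : F) k0).
rewrite -(cardC1 (0 : F)) cardE; apply: max_poly_roots => //; last exact: enum_uniq.
apply/allP => y; rewrite mem_enum inE => y0.
rewrite rootE !hornerE; have := h y; rewrite y0 /= negbK => /eqP ->.
by rewrite subrr.
Qed.

Lemma sum_expr_pred_card (F : finFieldType) : \sum_(x : F) x ^+ #|F|.-1 = -1.
Proof.
have q1 := finNzRing_gt1 F.
rewrite (bigD1 0) //= expr0n (gtn_eqF (_ : 0 < _)%N) ?add0r; last by rewrite -subn1 subn_gt0.
rewrite (eq_bigr (fun=> 1)) => [|x x0].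
  rewrite sumr_const cardC1 -subn1 natrB ?card_finField_eq0 ?sub0r //.
  by apply: ltnW.
by apply: (mulIf x0); rewrite -exprSr prednK ?expf_card ?mul1r // ltnW.
Qed.

Lemma sum_expr_shift (F : finFieldType) k : (0 < k)%N ->
  \sum_(x : F) x ^+ (k + #|F|.-1) = \sum_(x : F) x ^+ k.
Proof.
case: k => // k _; apply: eq_bigr => x _; have q1 := finNzRing_gt1 F.
by rewrite addSnnS prednK ?(ltnW q1) // exprD expf_card -exprSr.
Qed.

(** All powers of p are 1 modulo 4, so every p-adic digit of k = (p^r - 1) / 4 is (p - 1) / 4 and
    adding k to itself produces no carry. In terms of Legendre's formula, the floor of 2 k / p^j is
    twice that of k / p^j. *)
Lemma bin_half_not_dvdn p r k : prime p -> p = 1 %[mod 4] -> (p ^ r)%N = (4 * k).+1 ->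
  ~~ (p %| 'C(k.*2, k))%N.
Proof.
move=> pp p1 hk; have p0 := prime_gt0 pp.
have fl j : ((k.*2 %/ p ^ j) = (k %/ p ^ j) + (k %/ p ^ j))%N.
  have [jr|rj] := leqP j r; last first.
    have h : (p ^ r < p ^ j)%N by rewrite ltn_exp2l // prime_gt1.
    by rewrite !divn_small //; lia.
  have e1 i : (p ^ i = 1 %[mod 4])%N by rewrite -modnXm p1 modnXm exp1n.
  have e2 := divn_eq (p ^ j)%N 4; rewrite e1 in e2.
  have e3 := divn_eq (p ^ (r - j))%N 4; rewrite e1 in e3.
  move: e2 e3; set a := (_ %/ 4)%N; set b := (p ^ (r - j) %/ 4)%N => e2 e3.
  have kE : (k = b * p ^ j + a)%N.
    have : (p ^ (r - j) * p ^ j = p ^ r)%N by rewrite -expnD subnK.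
    by rewrite hk e3 e2 (modn_small (_ : 1 < 4)%N) //; lia.
  have P0 : (0 < p ^ j)%N by rewrite expn_gt0 p0.
  have aP : (4 * a < p ^ j)%N by lia.
  rewrite kE -addnn addnACA -mulnDl !divnMDl // !divn_small; lia.
have F0 n : (0 < n`!)%N by exact: fact_gt0.
have : logn p 'C(k.*2, k) = 0%N.
  have := congr1 (logn p) (bin_fact (leq_addl k k)); rewrite -addnn addnK.
  rewrite lognM ?muln_gt0 ?F0 ?bin_gt0 ?leq_addl //.
  rewrite lognM // !logn_fact //.
  have ext n : (n <= k + k)%N ->
      (\sum_(1 <= j < n.+1) n %/ p ^ j = \sum_(1 <= j < (k + k).+1) n %/ p ^ j)%N.
    move=> nk; rewrite [RHS](@big_cat_nat _ _ _ n.+1) //=.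
    rewrite [X in (_ + X)%N]big_nat [X in (_ + X)%N]big1 ?addn0 //.
    by move=> j /andP [nj _]; rewrite divn_small // (leq_trans nj) // ltnW // ltn_expl // prime_gt1.
  rewrite (ext k) ?leq_addl // -big_split /=.
  under [X in _ = X -> _]eq_bigr do rewrite addnn fl.
  by lia.
by move=> e; apply/negP => d; move: e; rewrite lognE pp d bin_gt0 -addnn leq_addl.
Qed.

(** Euler's criterion turns the sum into a power sum over F, where only monomials of degree q - 1
    survive. This leaves a central binomial coefficient, up to sign, modulo p. *)
Lemma jacobsthal_not_dvd (F : finFieldType) p r : prime p -> (0 < r)%N -> p = 1 %[mod 4] ->
  #|F| = (p ^ r)%N -> ~~ (p%:Z %| jacobsthal (1%R : F))%Z.
Proof.
move=> pp r0 p1 cF.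
have e1 : (p ^ r = 1 %[mod 4])%N by rewrite -modnXm p1 modnXm exp1n.
have [k hk] : exists k, (p ^ r)%N = (4 * k).+1.
  by exists (p ^ r %/ 4)%N; rewrite {1}(divn_eq (p ^ r) 4) e1; lia.
have pch : p \in [pchar F] by apply: card_finPcharP cF pp.
have oddF : odd #|F| by rewrite cF hk; lia.
have k0 : (0 < k)%N by have := finNzRing_gt1 F; rewrite cF hk; lia.
have : (jacobsthal (1 : F))%:~R = (-1) ^+ k.+1 * ('C(k.*2, k))%:R :> F.
  rewrite /jacobsthal rmorph_sum /=; have m : (#|F|.-1./2 = k.*2)%N by rewrite cF hk; lia.
  under eq_bigr => x _.
    rewrite qchar_intr // m (_ : x ^+ 3 - 1 * x = x * (x ^+ 2 - 1)); last by ring.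
    rewrite exprMn exprBn mulr_sumr.
    under eq_bigr => j _ do rewrite mulrnAr expr1n mulr1 [(-1) ^+ _ * _]mulrC mulrA -exprM -exprD.
    over.
  rewrite exchange_big /=.
  have kl : (k < k.*2.+1)%N by lia.
  have q4 : #|F|.-1 = (4 * k)%N by rewrite cF hk.
  transitivity (\sum_(i < k.*2.+1)
    (\sum_(x : F) x ^+ (k.*2 + 2 * (k.*2 - i))) * ((-1) ^+ i * ('C(k.*2, i))%:R)).
    apply: eq_bigr => i _; rewrite mulr_suml; apply: eq_bigr => x _.
    by rewrite mulrA mulr_natr.
  (* The exponents 6 k - 2 i lie between 2 k and 6 k, so only i = k gives a multiple of q - 1 = 4
     k. *)
  rewrite (bigD1 (Ordinal kl)) //= [X in _ + X]big1 ?addr0 => [|i].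
    rewrite (_ : (k.*2 + _)%N = #|F|.-1) ?sum_expr_pred_card; last by rewrite q4; lia.
    by rewrite mulrA mulN1r exprS mulN1r.
  rewrite -val_eqE /= => ik.
  have [lt_ik|lt_ki] : (i < k)%N \/ (k < i)%N by lia.
    rewrite (_ : (k.*2 + _)%N = (2 * (k - i) + #|F|.-1)%N); last by rewrite q4; lia.
    by rewrite sum_expr_shift ?sum_expr_small ?mul0r // ?q4; lia.
  by rewrite sum_expr_small ?mul0r // q4; have := ltn_ord i; lia.
move=> e; apply/negP => /dvdzP [c hc]; move/eqP: e; rewrite hc rmorphM /= -pmulrn.
rewrite (pcharf0 pch) mulr0 eq_sym mulf_eq0 signr_eq0 -(dvdn_pcharf pch) /=.
by apply/negP; apply: bin_half_not_dvdn pp p1 hk.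
Qed.

(** * The triple product modulo powers of q *)

Lemma eqX_eq N P Q : P = Q -> eqX N P Q.
Proof. by move->. Qed.

Lemma eqX_add N P P' Q Q' : eqX N P P' -> eqX N Q Q' -> eqX N (P + Q) (P' + Q').
Proof. by move=> hP hQ i le_iN; rewrite !coefD hP ?hQ. Qed.

Lemma eqX_sum N (I : Type) (r : seq I) (p : pred I) (P Q : I -> {poly int}) :
  (forall i, p i -> eqX N (P i) (Q i)) ->
  eqX N (\sum_(i <- r | p i) P i) (\sum_(i <- r | p i) Q i).
Proof.
move=> h; apply: (big_ind2 (eqX N)) => //; first by move=> *; apply: eqX_add.
Qed.

Lemma eqX_mulI N (P Q R : {poly int}) : P`_0 != 0 -> eqX N (P * Q) (P * R) -> eqX N Q R.
Proof.
move=> P0 h i le_iN; elim/ltn_ind: i le_iN => i IH le_iN.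
have := h i le_iN; rewrite !coefM !big_ord_recl /= !subn0.
rewrite (eq_bigr (fun j : 'I_i => P`_(bump 0 j) * R`_(i - bump 0 j))) => [|j _].
  by move/addIr/(mulfI P0).
by have ji := ltn_ord j; rewrite IH // /bump leq0n add1n; lia.
Qed.

Lemma eqX_Xn0 N k : (N < k)%N -> eqX N 'X^k 0.
Proof. by move=> lt i le; rewrite coefXn coef0; have /negPf-> : i != k by lia. Qed.

Lemma eqX_1subXn N k : (N < k)%N -> eqX N (1 - 'X^k) 1.
Proof.
move=> lt i le; rewrite coefB coefXn; have /negPf-> : i != k by lia.
by rewrite subr0.
Qed.

Lemma eqX_prod1 N (I : Type) (r : seq I) (p : pred I) (P : I -> {poly int}) :
  (forall i, p i -> eqX N (P i) 1) -> eqX N (\prod_(i <- r | p i) P i) 1.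
Proof.
move=> h; apply: (big_ind (fun Q => eqX N Q 1)) => // Q R hQ hR.
by rewrite -[X in eqX N _ X]mulr1; apply: eqX_mul.
Qed.

Lemma scale_intr (a : int) (P : {poly int}) : a *: P = a%:~R * P.
Proof. by rewrite -[a in LHS]intz scaler_int mulrzl. Qed.

Section TripleProduct.

Let x : {poly int} := 'X.

(** Finite form of Jacobi's triple product in z, the outer variable: the product of (1 + x^i z) (1 +
    x^(i+1) / z) over i < n, times z^n to make it a polynomial. *)
Definition jtp n : {poly {poly int}} :=
  (\prod_(i < n) (1 + (x ^+ i)%:P * 'X)) * (\prod_(i < n) ('X + (x ^+ i.+1)%:P)).

Lemma coef_comp_scale (R : comNzRingType) (P : {poly R}) (c : R) j :
  (P \Po (c%:P * 'X))`_j = c ^+ j * P`_j.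
Proof.
elim/poly_ind: P j => [|P a IH] j; first by rewrite comp_poly0 !coef0 mulr0.
rewrite comp_polyD comp_polyM comp_polyX comp_polyC !coefD !coefC mulrA.
rewrite !coefMX; case: j => [|j] /=; first by rewrite expr0 mul1r.
by rewrite coefMC IH !addr0 exprS; ring.
Qed.

(** Replacing z by x z shifts each of the two products by one factor. Multiplying by 1 + z first
    lets both shifts be expressed without division. *)
Lemma jtp_functional n :
  ('X + (x ^+ n)%:P) * (jtp n \Po (x%:P * 'X)) =
  (x ^+ n)%:P * (1 + (x ^+ n)%:P * 'X) * jtp n.
Proof.
have h : 1 + 'X != 0 :> {poly {poly int}}.
  by rewrite addrC -[1]opprK -polyCN polyXsubC_eq0.
apply: (mulfI h); rewrite /jtp comp_polyM.
rewrite !rmorph_prod /=.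
have -> : \prod_(i < n) ((1 + (x ^+ i)%:P * 'X) \Po (x%:P * 'X)) =
          \prod_(i < n) (1 + (x ^+ i.+1)%:P * 'X).
  apply: eq_bigr => i _; rewrite comp_polyD comp_polyM comp_polyX !comp_polyC.
  by rewrite mulrA -polyCM -exprSr.
have -> : \prod_(i < n) (('X + (x ^+ i.+1)%:P) \Po (x%:P * 'X)) =
          (x ^+ n)%:P * \prod_(i < n) ('X + (x ^+ i)%:P).
  rewrite (eq_bigr (fun i : 'I_n => x%:P * ('X + (x ^+ i)%:P))) => [|i _].
    by rewrite big_split /= prodr_const card_ord polyC_exp.
  by rewrite comp_polyD comp_polyX comp_polyC exprS polyCM; ring.
have e1 : (1 + 'X) * \prod_(i < n) (1 + (x ^+ i.+1)%:P * 'X) =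
   (\prod_(i < n) (1 + (x ^+ i)%:P * 'X)) * (1 + (x ^+ n)%:P * 'X).
  by rewrite -(big_ord_recr _ (fun i => 1 + (x ^+ i)%:P * 'X)) big_ord_recl expr0 mul1r.
have e2 : (1 + 'X) * \prod_(i < n) ('X + (x ^+ i.+1)%:P) =
   (\prod_(i < n) ('X + (x ^+ i)%:P)) * ('X + (x ^+ n)%:P).
  by rewrite -(big_ord_recr _ (fun i => 'X + (x ^+ i)%:P)) big_ord_recl expr0 [1 + _]addrC.
move: e1 e2; move: (\prod_(i < n) (1 + (x ^+ i.+1)%:P * 'X)).
move: (\prod_(i < n) (1 + (x ^+ i)%:P * 'X)) (\prod_(i < n) ('X + (x ^+ i.+1)%:P)).
move: (\prod_(i < n) ('X + (x ^+ i)%:P)) ((x ^+ n)%:P) => B' X A' B A e1 e2.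
transitivity (X * ((1 + 'X) * A) * (B' * ('X + X))); first by ring.
by rewrite e1 -e2; ring.
Qed.

Lemma jtp_rec n j : x ^+ j * (jtp n)`_j + x ^+ (n + j.+1) * (jtp n)`_j.+1 =
  x ^+ n * (jtp n)`_j.+1 + x ^+ (n + n) * (jtp n)`_j.
Proof.
have := congr1 (fun P : {poly _} => P`_j.+1) (jtp_functional n).
rewrite mulrDl coefD coefXM coefCM !coef_comp_scale /= -mulrA coefCM mulrDl mul1r.
by rewrite coefD -mulrA coefCM coefXM /= => e; rewrite !exprD -mulrA e; ring.
Qed.

Lemma jtp_up n k : (1 - x ^+ (n + k.+1)) * (jtp n)`_(n + k.+1) =
  (x ^+ k - x ^+ n) * (jtp n)`_(n + k).
Proof.
have x0 : x ^+ n != 0 by rewrite expf_neq0 // polyX_eq0.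
apply: (mulfI x0); have := jtp_rec n (n + k); rewrite -addnS.
rewrite !exprD; move: (_`_(n + k)) (_`_(n + k.+1)) => a b e.
by apply/eqP; rewrite eq_sym -subr_eq0; apply/eqP; move/eqP: e; rewrite -subr_eq0 => /eqP <-; ring.
Qed.

Lemma jtp_down n k : (k < n)%N -> (1 - x ^+ (n + k.+1)) * (jtp n)`_(n - k.+1) =
  x ^+ k.+1 * (1 - x ^+ (n - k)) * (jtp n)`_(n - k).
Proof.
move=> kn; have [m ->] : exists m, n = (m + k.+1)%N by exists (n - k.+1)%N; lia.
have -> : (m + k.+1 - k.+1)%N = m by lia.
have -> : (m + k.+1 - k)%N = m.+1 by lia.
have x0 : x ^+ m != 0 by rewrite expf_neq0 // polyX_eq0.
apply: (mulfI x0); have := jtp_rec (m + k.+1) m.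
move: (_`_m) (_`_m.+1) => a b; rewrite !(exprD, exprS) => e.
by apply/eqP; rewrite -subr_eq0; apply/eqP; move/eqP: e; rewrite -subr_eq0 => /eqP <-; ring.
Qed.

Definition tri k := 'C(k.+1, 2).

Lemma triS k : tri k.+1 = (tri k + k.+1)%N.
Proof. by rewrite /tri binS bin1 addnC. Qed.

Lemma leq_tri k : (k <= tri k)%N.
Proof. by elim: k => // k _; rewrite triS leq_addl. Qed.

Lemma jtp_coef0 n : (jtp n)`_0 = x ^+ tri n.
Proof.
rewrite -horner_coef0 /jtp hornerM !horner_prod.
rewrite big1 => [|i _]; last by rewrite !hornerE ?mulr0 ?addr0.
rewrite mul1r; elim: n => [|n IH]; first by rewrite big_ord0.
by rewrite big_ord_recr /= IH !hornerE ?add0r -exprD triS.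
Qed.

(** Descending with [jtp_down] from the middle coefficient to the constant one, which is known,
    identifies the middle coefficient as a Gaussian binomial. *)
Lemma jtp_center n :
  \prod_(i < n) (1 - x ^+ (n + i.+1)) = (\prod_(i < n) (1 - x ^+ (n - i))) * (jtp n)`_n.
Proof.
have h k : (k <= n)%N -> \prod_(i < k) (1 - x ^+ (n + i.+1)) * (jtp n)`_(n - k) =
   x ^+ tri k * (\prod_(i < k) (1 - x ^+ (n - i))) * (jtp n)`_n.
  elim: k => [_|k IH kn]; first by rewrite !big_ord0 subn0 !mul1r.
  rewrite !big_ord_recr /= -mulrA jtp_down // mulrCA IH 1?ltnW // triS exprD.
  by ring.
have x0 : x ^+ tri n != 0 by rewrite expf_neq0 // polyX_eq0.
have := h n (leqnn n); rewrite subnn jtp_coef0 mulrC => e.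
by apply: (mulfI x0); rewrite e mulrA.
Qed.

Variable N : nat.
Let n := N.+1.
Notation e1 := (euler_trunc 1 N).
Notation e2 := (euler_trunc 2 N).
Let c := (jtp n)`_n.

Lemma jtp_center_euler : eqX N (c * e1) 1.
Proof.
apply: (@eqX_trans _ _ (\prod_(i < n) (1 - x ^+ (n + i.+1)))); last first.
  by apply: eqX_prod1 => i _; apply: eqX_1subXn; rewrite /n; lia.
rewrite jtp_center mulrC; apply: eqX_mul => //.
rewrite [X in eqX N _ X](reindex_inj rev_ord_inj) /=.
apply: (eqX_trans (euler_trunc_stable (_ : 0 < 1)%N (leqnSn N))) => //.
rewrite /euler_trunc big_add1 big_mkord.
rewrite (eq_bigr (fun i : 'I_n => 1 - x ^+ (n - (n - i.+1)))) => [|i _] //.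
by rewrite mul1n subKn.
Qed.

(** Modulo x^(N+1) the recurrence multiplies by x^j at step j, and these exponents add up to a
    triangular number. *)
Lemma jtp_up_approx k : (k < n)%N -> eqX N (jtp n)`_(n + k.+1) (x ^+ tri k * c).
Proof.
have step j : eqX N (jtp n)`_(n + j.+1) (x ^+ j * (jtp n)`_(n + j)).
  apply: (@eqX_trans _ _ ((1 - x ^+ (n + j.+1)) * (jtp n)`_(n + j.+1))).
    rewrite -[X in eqX N X _]mul1r; apply: eqX_mul => //; apply: eqX_sym.
    by apply: eqX_1subXn; rewrite /n; lia.
  rewrite jtp_up; apply: eqX_mul => //; rewrite -[X in eqX N _ X]subr0.
  apply: eqX_add => // i le; rewrite !coefN; congr (- _).
  by apply: eqX_Xn0 le; rewrite /n.
elim: k => [|k IH] kn; first by apply: eqX_trans (step 0%N) _; rewrite addn0.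
apply: eqX_trans (step k.+1) _.
rewrite triS [(tri k + _)%N]addnC [x ^+ (k.+1 + tri k)]exprD -mulrA.
by apply: eqX_mul => //; apply/IH/ltnW.
Qed.

Lemma jtp_down_approx k : (k <= n)%N -> eqX N (jtp n)`_(n - k) (x ^+ tri k * c).
Proof.
elim: k => [|k IH] kn; first by rewrite subn0 mul1r.
apply: (@eqX_trans _ _ ((1 - x ^+ (n + k.+1)) * (jtp n)`_(n - k.+1))).
  rewrite -[X in eqX N X _]mul1r; apply: eqX_mul => //; apply: eqX_sym.
  by apply: eqX_1subXn; rewrite /n; lia.
rewrite jtp_down // mulrBr mulr1 -exprD triS [(tri k + _)%N]addnC.
rewrite [x ^+ (k.+1 + tri k)]exprD -mulrA.
apply: eqX_mul; last exact/IH/ltnW.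
rewrite -[X in eqX N _ X]subr0; apply: eqX_add => // i le; rewrite !coefN.
by congr (- _); apply: eqX_Xn0 le; rewrite /n; lia.
Qed.

Lemma sum_jtp (w : nat -> int) :
  eqX N (\sum_(j < (n + n).+1) w j *: (jtp n)`_j)
        (c * \sum_(k < n) (w (n + k.+1)%N + w (n - k)%N) *: x ^+ tri k).
Proof.
(* The indices n + k + 1 and n - k share the exponent [tri k]; index 0 has no partner, but its
   coefficient vanishes at this precision. *)
have tn : eqX N (x ^+ tri n * c) 0.
  rewrite -[X in eqX N _ X](mul0r c); apply: eqX_mul => //; apply: eqX_Xn0.
  by apply: leq_trans (leq_tri _).
rewrite -addSn big_split_ord /=.
apply: (@eqX_trans _ _ (\sum_(k < n.+1) w (n - k)%N *: (x ^+ tri k * c) +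
    \sum_(k < n) w (n + k.+1)%N *: (x ^+ tri k * c))).
  apply: eqX_add.
    rewrite (reindex_inj rev_ord_inj) /=; apply: eqX_sum => i _.
    move=> j le; rewrite !coefZ; congr (_ * _); rewrite subSS.
    by apply: jtp_down_approx le; rewrite -ltnS.
  apply: eqX_sum => i _ j le; rewrite !coefZ addSnnS; congr (_ * _).
  exact: jtp_up_approx le.
rewrite big_ord_recr /=.
apply: (@eqX_trans _ _ ((\sum_(k < n) w (n - k)%N *: (x ^+ tri k * c) + 0) +
    \sum_(k < n) w (n + k.+1)%N *: (x ^+ tri k * c))).
  apply: eqX_add => //; apply: eqX_add => // i le; rewrite coefZ tn // coef0.
  by rewrite mulr0.
rewrite addr0 -big_split mulr_sumr; apply: eqX_eq; apply: eq_bigr => k _ /=.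
by rewrite [_ * c]mulrC -scalerAr -scalerDl addrC.
Qed.

Lemma size_jtp : (size (jtp n) <= (n + n).+1)%N.
Proof.
have h (f : 'I_n -> {poly {poly int}}) : (forall i, size (f i) <= 2%N)%N ->
    (size (\prod_(i < n) f i)%R <= n.+1)%N.
  move=> hf; apply: leq_trans (size_poly_prod_leq _ _) _.
  rewrite card_ord leq_subLR addnS ltnS.
  apply: (@leq_trans (\sum_(i < n) 2)%N); first exact: leq_sum.
  by rewrite sum_nat_const card_ord muln2 addnn.
apply: leq_trans (size_polyMleq _ _) _.
have hC (a : {poly int}) : (size (a%:P : {poly {poly int}}) <= 1)%N.
  exact: size_polyC_leq1.
have hA : (size (\prod_(i < n) (1 + (x ^+ i)%:P * 'X) : {poly {poly int}})%R <= n.+1)%N.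
  apply: h => i; apply: leq_trans (size_polyD _ _) _; rewrite geq_max size_poly1 /=.
  apply: leq_trans (size_polyMleq _ _) _; rewrite size_polyX.
  by rewrite addn2 /= ltnS hC.
have hB : (size (\prod_(i < n) ('X + (x ^+ i.+1)%:P) : {poly {poly int}})%R <= n.+1)%N.
  by apply: h => i; rewrite size_XaddC.
by rewrite -subn1 leq_subLR add1n -addnS -addSn; apply: leq_add.
Qed.

Definition theta (w : nat -> int) : {poly int} := \sum_(k < n) w k *: x ^+ tri k.

Lemma euler_truncE d : euler_trunc d N = \prod_(i < N) (1 - x ^+ (d * i.+1)).
Proof. by rewrite /euler_trunc big_add1 big_mkord. Qed.

(** This is the triple product at z = 1: the product side becomes twice the square of [g], with g e1
    = e2. *)
Lemma gauss_triangular : eqX N (e1 * theta (fun=> 1)) (e2 ^+ 2).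
Proof.
have h : eqX N (jtp n).[1] (c * (2 * theta (fun=> 1))).
  rewrite (horner_coef_wide _ size_jtp).
  rewrite (eq_bigr (fun j : 'I_(n + n).+1 => 1 *: (jtp n)`_j)) => [|j _].
    apply: eqX_trans (sum_jtp (fun=> 1)) _; apply: eqX_eq; congr (_ * _).
    rewrite /theta mulr_sumr; apply: eq_bigr => k _.
    by rewrite scalerDl scale1r; ring.
  by rewrite expr1n mulr1 scale1r.
pose g : {poly int} := \prod_(i < N) (1 + x ^+ i.+1).
have ge : g * e1 = e2.
  rewrite !euler_truncE -big_split /=; apply: eq_bigr => i _.
  by rewrite mul1n mulnC exprM; ring.
have hg : eqX N (jtp n).[1] (2 * (g * g)).
  rewrite /jtp hornerM !horner_prod.
  rewrite (eq_bigr (fun i : 'I_n => 1 + x ^+ i)) => [|i _]; last by rewrite !hornerE.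
  rewrite [X in _ * X](eq_bigr (fun i : 'I_n => 1 + x ^+ i.+1)) => [|i _].
    apply: (@eqX_trans _ _ (2 * (g * g) * (1 + x ^+ n))).
      by apply: eqX_eq; rewrite big_ord_recl big_ord_recr /= expr0 -!/g; ring.
    rewrite -[X in eqX N _ X]mulr1; apply: eqX_mul => //.
    by rewrite -[X in eqX N _ X]addr0; apply: eqX_add => //; apply: eqX_Xn0.
  by rewrite !hornerE.
apply: (@eqX_mulI _ 2); first by rewrite -polyC_natr coefC.
apply: (@eqX_trans _ _ ((2 * theta (fun=> 1) * e1) * (c * e1))).
  rewrite -[X in eqX N X _]mulr1 mulrA [2 * e1 * _]mulrAC.
  by apply: eqX_mul => //; apply/eqX_sym/jtp_center_euler.
apply: (@eqX_trans _ _ ((c * (2 * theta (fun=> 1))) * e1 ^+ 2)).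
  by apply: eqX_eq; ring.
apply: (@eqX_trans _ _ ((jtp n).[1] * e1 ^+ 2)).
  by apply: eqX_mul => //; apply: eqX_sym.
apply: (@eqX_trans _ _ (2 * (g * g) * e1 ^+ 2)); first exact: eqX_mul.
by apply: eqX_eq; rewrite -ge; ring.
Qed.

(** At z = -1 the triple product has the simple zero 1 + z, so it is differentiated first. The
    operator z d/dz - n weights a coefficient by its distance from the centre, and the paired
    distances k + 1 and -k have opposite signs, whence 2 k + 1. *)
Lemma jacobi_cube : eqX N (e1 ^+ 3) (theta (fun k => (-1) ^+ k * (2 * k%:R + 1))).
Proof.
pose J := theta (fun k => (-1) ^+ k * (2 * k%:R + 1)).
pose P : {poly {poly int}} := 'X * (jtp n)^`() - n%:R * jtp n.
pose w j : int := (-1) ^+ j * (j%:R - n%:R).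
have coefP j : P`_j = (j%:R - n%:R) * (jtp n)`_j.
  rewrite coefB -polyC_natr coefCM coefXM mulrBl; congr (_ - _).
  case: j => [|j] /=; first by rewrite mul0r.
  by rewrite coef_deriv mulr_natl.
have sizeP : (size P <= (n + n).+1)%N.
  apply/leq_sizeP => j hj; rewrite coefP (leq_sizeP _ _ size_jtp) ?mulr0 //.
have PE : P.[-1] = \sum_(j < (n + n).+1) w j *: (jtp n)`_j.
  rewrite (horner_coef_wide _ sizeP); apply: eq_bigr => j _.
  rewrite coefP /w scale_intr rmorphM rmorphXn rmorphN1 rmorphB /= !rmorph_nat.
  by rewrite mulrC mulrA.
have P1 : eqX N P.[-1] (c * ((-1) ^+ N *: J)).
  rewrite PE; apply: eqX_trans (sum_jtp w) _; apply: eqX_eq; congr (_ * _).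
  rewrite /J /theta scaler_sumr; apply: eq_bigr => k _.
  rewrite scalerA; congr (_ *: _); case: k => k /= kn.
  have [m mE] : exists m, N = (m + k)%N by exists (N - k)%N; rewrite subnK // -ltnS.
  have -> : (n - k)%N = m.+1 by rewrite /n mE -addSn addnK.
  rewrite /w natrD addrAC subrr add0r /n mE !exprD !exprS !exprD.
  have e2 : (-1) ^+ k * (-1) ^+ k = 1 :> int by rewrite -expr2 sqrr_sign.
  rewrite -!natr1 natrD; move: ((-1) ^+ k) ((-1) ^+ m) e2 => e f e2.
  transitivity (f * ((e * e) * (k%:R + 1) + k%:R)); first by ring.
  transitivity (f * (e * e) * (2 * k%:R + 1)); last by ring.
  by rewrite e2; ring.
have P2 : eqX N P.[-1] ((-1) ^+ N *: e1 ^+ 2).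
  pose Q : {poly {poly int}} := (\prod_(i < N) (1 + (x ^+ i.+1)%:P * 'X)) *
    (\prod_(i < n) ('X + (x ^+ i.+1)%:P)).
  have jE : jtp n = (1 + 'X) * Q.
    by rewrite /jtp big_ord_recl /= expr0 mul1r mulrA.
  have -> : P.[-1] = - Q.[-1].
    have d1 : (1 : {poly {poly int}})^`() = 0 by rewrite -polyC1 derivC.
    rewrite /P jE; clearbody Q; rewrite derivM derivD derivX d1.
    by rewrite !(hornerD, hornerN, hornerM, hornerX, hornerC); ring.
  rewrite /Q hornerM !horner_prod.
  rewrite (eq_bigr (fun i : 'I_N => 1 - x ^+ (1 * i.+1))) => [|i _]; last first.
    by rewrite mul1n !hornerE; ring.
  rewrite -euler_truncE.
  rewrite [X in - (_ * X)](eq_bigr (fun i : 'I_n => - 1 * (1 - x ^+ (1 * i.+1))))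
    => [|i _]; last first.
    by rewrite mul1n !hornerE; ring.
  rewrite big_split /= prodr_const card_ord big_ord_recr /= -euler_truncE.
  rewrite scale_intr rmorphXn rmorphN1 /n exprS.
  apply: (@eqX_trans _ _ ((-1) ^+ N * e1 ^+ 2 * (1 - x ^+ (1 * N.+1)))).
    by apply: eqX_eq; ring.
  by rewrite -[X in eqX N _ X]mulr1; apply: eqX_mul => //; apply: eqX_1subXn; rewrite mul1n.
have h : eqX N (e1 ^+ 2) (c * J).
  move=> i le; have := P1 i le; rewrite P2 // -scalerAr !coefZ.
  by apply: mulfI; rewrite signr_eq0.
rewrite exprS; apply: (@eqX_trans _ _ (e1 * (c * J))); first exact: eqX_mul.
rewrite mulrA [e1 * c]mulrC -[X in eqX N _ X]mul1r.
by apply: eqX_mul => //; apply: jtp_center_euler.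
Qed.

End TripleProduct.

(** * A quartic theta identity *)

Lemma tri_double k : (tri k * 2 = k * k.+1)%N.
Proof. by elim: k => // k IH; rewrite triS mulnDl IH; lia. Qed.

Section ThetaQuartic.

Variable N : nat.
Let n := N.+1.

(** The odd integers are written 2 t + 1, with (2 t + 1)^2 = 8 [triz t] + 1; [Posz k] and [Negz k]
    give opposite odd integers. *)
Definition triz (t : int) : nat := match t with Posz k => tri k | Negz k => tri k end.

Lemma trizE t : (triz t)%:Z * 2 = t * (t + 1).
Proof.
case: t => k /=; have := tri_double k; rewrite ?NegzE => h.
  by rewrite -[2]/(2%:Z) -PoszM h; lia.
by rewrite -[2]/(2%:Z) -PoszM h; lia.
Qed.

Definition box : seq int := map Posz (iota 0 n) ++ map Negz (iota 0 n).

Lemma mem_box t : (triz t <= N)%N -> t \in box.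
Proof.
rewrite mem_cat => h; apply/orP; case: t h => k h; [left|right];
  apply: map_f; rewrite mem_iota add0n /n ltnS;
  exact: leq_trans (leq_tri k) h.
Qed.

Lemma uniq_box : uniq box.
Proof.
rewrite cat_uniq; apply/and3P; split.
- by rewrite map_inj_uniq ?iota_uniq // => a b [].
- by apply/hasPn => _ /mapP [k _ ->]; apply/mapP => -[].
- by rewrite map_inj_uniq ?iota_uniq // => a b [].
Qed.

Notation Z4 := (int * int * int * int)%type.

Definition box4 : seq Z4 :=
  [seq (p, d) | p <- [seq (p, c) | p <- [seq (a, b) | a <- box, b <- box], c <- box],
                d <- box].

Definition triz4 (t : Z4) := let: (a, b, c, d) := t in
  (triz a + triz b + triz c + triz d)%N.

Lemma mem_box4 t : (triz4 t <= N)%N -> t \in box4.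
Proof.
case: t => [[[a b] c] d] /= h.
by do 3?[apply: allpairs_f; last by apply: mem_box; lia]; apply: mem_box; lia.
Qed.

Lemma uniq_box4 : uniq box4.
Proof.
have U := uniq_box.
by do 3!(apply: allpairs_uniq => //; last by move=> [? ?] [? ?] _ _ /= [-> ->]).
Qed.

(** Equivalently, the odd vector (2 a + 1, .., 2 d + 1) has coordinate sum 2 modulo 4. *)
Definition odd4 (t : Z4) : bool := let: (a, b, c, d) := t in
  ((a + b + c + d) %% 2)%Z == 1.

(** On the odd vector (2 a + 1, .., 2 d + 1) this is half a symmetric 4 x 4 Hadamard matrix; [u]
    encodes half the coordinate sum. *)
Definition hadamard (t : Z4) : Z4 := let: (a, b, c, d) := t in
  let u := ((a + b + c + d + 1) %/ 2)%Z in
  (u, u - c - d - 1, u - b - d - 1, u - b - c - 1).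

Lemma odd4P a b c d : odd4 (a, b, c, d) -> exists s, a = s * 2 + 1 - b - c - d.
Proof.
move=> /eqP h; exists ((a + b + c + d) %/ 2)%Z.
by have := divz_eq (a + b + c + d) 2; rewrite h => e; lia.
Qed.

Lemma hadamardE b c d s : hadamard (s * 2 + 1 - b - c - d, b, c, d) =
  (s + 1, s - c - d, s - b - d, s - b - c).
Proof.
rewrite /hadamard; set u := (_ %/ 2)%Z; have -> : u = s + 1 by rewrite /u; lia.
by congr (_, _, _, _); lia.
Qed.

Lemma hadamard_odd4 t : odd4 t -> odd4 (hadamard t).
Proof.
case: t => [[[a b] c] d] /odd4P [s ->]; rewrite hadamardE /odd4.
by apply/eqP; lia.
Qed.

Lemma hadamardK t : odd4 t -> hadamard (hadamard t) = t.
Proof.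
case: t => [[[a b] c] d] /odd4P [s ->]; rewrite hadamardE.
rewrite /hadamard; set u := (_ %/ 2)%Z.
have -> : u = s * 2 + 1 - b - c - d by rewrite /u; lia.
by congr (_, _, _, _); lia.
Qed.

Lemma triz4_hadamard t : odd4 t -> triz4 (hadamard t) = triz4 t.
Proof.
case: t => [[[a b] c] d] /odd4P [s ->]; rewrite hadamardE /triz4.
apply/eqP; rewrite -(eqr_nat int) -(inj_eq (mulIf (_ : 2 != 0 :> int))) // !natrD !mulrDl.
by rewrite !natz !trizE; apply/eqP; ring.
Qed.

Definition prodx (t : Z4) : int := let: (a, b, c, d) := t in
  (2 * a + 1) * (2 * b + 1) * (2 * c + 1) * (2 * d + 1).

Definition heron (t : Z4) : int := let: (a, b, c, d) := t in
  let: (x, y, z, w) := (2 * a + 1, 2 * b + 1, 2 * c + 1, 2 * d + 1) in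
  x ^+ 4 + y ^+ 4 + z ^+ 4 + w ^+ 4 - 2 * (x ^+ 2 * y ^+ 2 + x ^+ 2 * z ^+ 2 +
    x ^+ 2 * w ^+ 2 + y ^+ 2 * z ^+ 2 + y ^+ 2 * w ^+ 2 + z ^+ 2 * w ^+ 2).

Lemma prodx_hadamard t : odd4 t -> 16 * prodx (hadamard t) = heron t + 8 * prodx t.
Proof.
case: t => [[[a b] c] d] /odd4P [s ->]; rewrite hadamardE /prodx /heron /=.
by ring.
Qed.

Lemma sum_odd4 i : (i <= N)%N ->
  \sum_(t <- box4 | (triz4 t == i) && odd4 t) (heron t - 8 * prodx t) = 0.
Proof.
move=> iN; rewrite -big_filter; set W := filter _ _.
have memW t : (t \in W) = (triz4 t == i) && odd4 t.
  rewrite mem_filter; apply: andb_idr => /andP [/eqP e _].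
  by apply: mem_box4; rewrite e.
have UW : uniq W by rewrite filter_uniq ?uniq_box4.
have HW t : t \in W -> hadamard t \in W.
  by rewrite !memW => /andP [/eqP e o]; rewrite triz4_hadamard // e eqxx hadamard_odd4.
have pW : perm_eq (map hadamard W) W.
  apply: uniq_perm => //.
    rewrite map_inj_in_uniq // => t u; rewrite !memW => /andP [_ ot] /andP [_ ou] e.
    by rewrite -(hadamardK ot) e hadamardK.
  move=> t; apply/mapP/idP => [[u uW ->]|tW]; first exact: HW.
  exists (hadamard t); first exact: HW.
  by rewrite hadamardK //; move: tW; rewrite memW => /andP [].
have : \sum_(t <- W) 16 * prodx t = \sum_(t <- W) (heron t + 8 * prodx t).
  rewrite -(perm_big _ pW) big_map big_seq [RHS]big_seq.
  by apply: eq_bigr => t; rewrite memW => /andP [_ o]; rewrite prodx_hadamard.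
move/eqP; rewrite eq_sym -subr_eq0 -sumrB => /eqP e.
by rewrite -[RHS]e; apply: eq_bigr => t _; ring.
Qed.

(** This is (-1)^t, in other words the character modulo 4 at 2 t + 1. *)
Definition sgnz (t : int) : int := match t with Posz k => (-1) ^+ k | Negz k => - (-1) ^+ k end.

Definition sgn4 (t : Z4) : int := let: (a, b, c, d) := t in
  sgnz a * sgnz b * sgnz c * sgnz d.

Lemma sgnz_mod2 t : sgnz t = 1 - 2 * (t %% 2)%Z.
Proof.
case: t => k; rewrite /sgnz -signr_odd; last rewrite NegzE.
  by case: (boolP (odd k)) => h; rewrite ?expr1 ?expr0; lia.
by case: (boolP (odd k)) => h; rewrite ?expr1 ?expr0; lia.
Qed.

(** The parity condition becomes a difference of two weights that factor over the coordinates, so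
    that the restricted sum splits into products of theta series. *)
Lemma sgn4_odd4 t : 1 - sgn4 t = 2 * (odd4 t)%:R.
Proof.
case: t => [[[a b] c] d]; rewrite /sgn4 /odd4 !sgnz_mod2.
have h (x : int) : (x %% 2)%Z = 0 \/ (x %% 2)%Z = 1 by lia.
case: eqP => e.
  by case: (h a) => ea; case: (h b) => eb; case: (h c) => ec; case: (h d) => ed;
    rewrite ea eb ec ed ?mul1r; lia.
by case: (h a) => ea; case: (h b) => eb; case: (h c) => ec; case: (h d) => ed;
    rewrite ea eb ec ed; lia.
Qed.

Definition sum4 (g : Z4 -> int) : {poly int} := \sum_(t <- box4) g t *: 'X^(triz4 t).

Lemma sum4_cancel : eqX N (sum4 (fun t => (heron t - 8 * prodx t) * (1 - sgn4 t))) 0.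
Proof.
move=> i iN; rewrite coef_sum coef0.
transitivity (2 * \sum_(t <- box4 | (triz4 t == i) && odd4 t) (heron t - 8 * prodx t)).
  rewrite mulr_sumr [RHS]big_mkcond; apply: eq_bigr => t _.
  rewrite coefZ coefXn sgn4_odd4 [i == _]eq_sym.
  by case: (triz4 t == i); case: (odd4 t) => /=; ring.
by rewrite sum_odd4 // mulr0.
Qed.

Definition thetaz (g : int -> int) : {poly int} := \sum_(t <- box) g t *: 'X^(triz t).

Lemma sum4_prod g1 g2 g3 g4 :
  sum4 (fun t => let: (a, b, c, d) := t in g1 a * g2 b * g3 c * g4 d) =
  thetaz g1 * thetaz g2 * thetaz g3 * thetaz g4.
Proof.
rewrite /sum4 /box4 !big_allpairs.
pose M (g : int -> int) t : {poly int} := g t *: 'X^(triz t).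
transitivity (\sum_(a <- box) \sum_(b <- box) \sum_(c <- box) \sum_(d <- box)
  M g1 a * M g2 b * M g3 c * M g4 d).
  do 4!apply: eq_bigr => ? _.
  by rewrite /M !scale_intr !rmorphM !exprD /=; ring.
under eq_bigr => a _ do under eq_bigr => b _ do under eq_bigr => c _ do
  rewrite -mulr_sumr.
under eq_bigr => a _ do under eq_bigr => b _ do rewrite -mulr_suml -mulr_sumr.
under eq_bigr => a _ do rewrite -!mulr_suml -mulr_sumr.
by rewrite -!mulr_suml.
Qed.

Lemma thetaz_even g : (forall k, g (Negz k) = g (Posz k)) ->
  thetaz g = 2 * theta N (fun k => g k%:Z).
Proof.
move=> hg; rewrite /thetaz big_cat !big_map /theta -[iota 0 n]/(index_iota 0 n).
rewrite !big_mkord mulr_sumr /= -big_split; apply: eq_bigr => k _.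
by rewrite hg /=; ring.
Qed.

Lemma thetaz_odd g : (forall k, g (Negz k) = - g (Posz k)) -> thetaz g = 0.
Proof.
move=> hg; rewrite /thetaz big_cat !big_map -[iota 0 n]/(index_iota 0 n).
rewrite !big_mkord /= -big_split big1 // => k _ /=.
by rewrite hg scaleNr subrr.
Qed.

(** Each monomial of [sum4_cancel] is a product of four one-variable sums. Under t -> -1 - t the
    untwisted sums of odd degree vanish, and so do the twisted ones of even degree; only [J]
    survives among the latter. *)
Lemma theta_quartic :
  let J := theta N (fun k => (-1) ^+ k * (2 * k%:R + 1)) in
  let T j := theta N (fun k => (2 * k%:R + 1) ^+ j) in
  eqX N (2 * J ^+ 4) (T 0 ^+ 2 * (3 * T 2 ^+ 2 - T 4 * T 0)).
Proof.
move=> J T.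
have sum4D g h : sum4 (fun t => g t + h t) = sum4 g + sum4 h.
  by rewrite -big_split; apply: eq_bigr => t _; rewrite scalerDl.
have sum4Z (a : int) g : sum4 (fun t => a * g t) = a%:~R * sum4 g.
  by rewrite -scale_intr scaler_sumr; apply: eq_bigr => t _; rewrite scalerA.
pose X j (t : int) := (2 * t + 1) ^+ j.
pose Xs j (t : int) := X j t * sgnz t.
have xN k : 2 * Negz k + 1 = - (2 * Posz k + 1) :> int by rewrite NegzE; lia.
have xP k : 2 * Posz k + 1 = 2 * k%:R + 1 :> int by rewrite [k%:R]natz.
have TX j : ~~ odd j -> thetaz (X j) = 2 * T j.
  move=> oj; rewrite thetaz_even => [|k]; last first.
    by rewrite /X xN exprNn -signr_odd (negPf oj) mul1r.
  by congr (_ * _); apply: eq_bigr => k _; rewrite /X xP.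
have TXs j : ~~ odd j -> thetaz (Xs j) = 0.
  move=> oj; rewrite thetaz_odd // => k.
  by rewrite /Xs /X xN exprNn -signr_odd (negPf oj) mul1r /= mulrN.
have TX1 : thetaz (X 1) = 0.
  by rewrite thetaz_odd // => k; rewrite /X xN !expr1.
have TXs1 : thetaz (Xs 1) = 2 * J.
  rewrite thetaz_even => [|k]; last first.
    by rewrite /Xs /X xN !expr1 /= mulrNN.
  congr (_ * _); apply: eq_bigr => k _.
  by rewrite /Xs /X xP expr1 /= mulrC.
pose m (g1 g2 g3 g4 : int -> int) (t : Z4) : int :=
  let: (a, b, c, d) := t in g1 a * g2 b * g3 c * g4 d.
pose S (g1 g2 g3 g4 : int -> int) := sum4 (m g1 g2 g3 g4).
have SE g1 g2 g3 g4 : S g1 g2 g3 g4 = thetaz g1 * thetaz g2 * thetaz g3 * thetaz g4.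
  exact: sum4_prod.
pose H (Y : nat -> int -> int) t : int :=
  m (Y 4) (Y 0) (Y 0) (Y 0) t + m (Y 0) (Y 4) (Y 0) (Y 0) t +
  m (Y 0) (Y 0) (Y 4) (Y 0) t + m (Y 0) (Y 0) (Y 0) (Y 4) t +
  (-2) * (m (Y 2) (Y 2) (Y 0) (Y 0) t + m (Y 2) (Y 0) (Y 2) (Y 0) t +
     m (Y 2) (Y 0) (Y 0) (Y 2) t + m (Y 0) (Y 2) (Y 2) (Y 0) t +
     m (Y 0) (Y 2) (Y 0) (Y 2) t + m (Y 0) (Y 0) (Y 2) (Y 2) t) +
  (-8) * m (Y 1) (Y 1) (Y 1) (Y 1) t.
have HE (Y : nat -> int -> int) : sum4 (H Y) =
  4 * thetaz (Y 4) * thetaz (Y 0) ^+ 3 - 12 * thetaz (Y 2) ^+ 2 * thetaz (Y 0) ^+ 2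
  - 8 * thetaz (Y 1) ^+ 4.
  rewrite /H !(sum4D, sum4Z) -!/(S _ _ _ _) !SE !rmorphN /=.
  by ring.
have e : sum4 (fun t => (heron t - 8 * prodx t) * (1 - sgn4 t)) =
    sum4 (H X) + (-1)%:~R * sum4 (H Xs).
  rewrite -sum4Z -sum4D; apply: eq_bigr => -[[[a b] c] d] _; congr (_ *: _).
  by rewrite /H /heron /prodx /sgn4 /m /Xs /X; ring.
have := sum4_cancel; rewrite e !HE TX1 TXs1 !TX ?TXs // => h.
(* Each of the four theta factors is twice its half-range sum, which gives 16, and the coefficients
   4, 12 and 8 of [HE] share a factor 4. *)
apply: (@eqX_mulI _ 64); first by rewrite -polyC_natr coefC.
have h64 := eqX_add (@eqX_refl N (64 * (T 0 ^+ 2 * (3 * T 2 ^+ 2 - T 4 * T 0)))) h.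
rewrite addr0 in h64; apply: eqX_trans h64; apply: eqX_eq.
by rewrite rmorphN1; ring.
Qed.

End ThetaQuartic.

(** * The eta quotient *)

Definition flipX (P : {poly int}) := P \Po ((-1)%:P * 'X).

Lemma coef_flipX P i : (flipX P)`_i = (-1) ^+ i * P`_i.
Proof. exact: coef_comp_scale. Qed.

Lemma eqX_flipX N P Q : eqX N P Q -> eqX N (flipX P) (flipX Q).
Proof. by move=> h i le; rewrite !coef_flipX h. Qed.

Lemma flipXM P Q : flipX (P * Q) = flipX P * flipX Q.
Proof. exact: comp_polyM. Qed.

Lemma flipX_exp P k : flipX (P ^+ k) = flipX P ^+ k.
Proof. exact: rmorphXn. Qed.

Lemma flipX_prod n (f : 'I_n -> {poly int}) :
  flipX (\prod_(i < n) f i) = \prod_(i < n) flipX (f i).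
Proof. exact: rmorph_prod. Qed.

Lemma flipX_nat k : flipX k%:R = k%:R.
Proof. exact: rmorph_nat. Qed.

Lemma flipX_1subXn k : flipX (1 - 'X^k) = 1 - (-1) ^+ k * 'X^k.
Proof.
rewrite /flipX comp_polyB comp_Xn_poly exprMn polyCN polyC1.
by rewrite -[X in X \Po _]polyC1 comp_polyC.
Qed.

Lemma euler_trunc_odd_even d N : euler_trunc d N.*2 =
  (\prod_(i < N) (1 - 'X^(d * i.*2.+1))) * euler_trunc (2 * d) N.
Proof.
rewrite !euler_truncE; elim: N => [|N IH]; first by rewrite !big_ord0 mulr1.
rewrite doubleS !big_ord_recr /= IH.
have -> : (d * N.*2.+2 = 2 * d * N.+1)%N.
  by rewrite -doubleS -mul2n mulnA [(d * 2)%N]mulnC.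
by ring.
Qed.

Lemma coef0_expr (P : {poly int}) k : P`_0 = 1 -> (P ^+ k)`_0 = 1.
Proof. by move=> P0; rewrite -!horner_coef0 horner_exp horner_coef0 P0 expr1n. Qed.

Lemma coef0_mul (P Q : {poly int}) : P`_0 = 1 -> Q`_0 = 1 -> (P * Q)`_0 = 1.
Proof. by move=> P0 Q0; rewrite coef0M P0 Q0 mulr1. Qed.

Section EtaQuotient.

Variable N : nat.
Notation e d := (euler_trunc d N).
Let T j := theta N (fun k => (2 * k%:R + 1) ^+ j).
Let Q := 3 * T 2 ^+ 2 - T 4 * T 0.

(** Four of the cubes of e1 are Jacobi's series to which [theta_quartic] applies; the remaining e1^2
    absorbs the square of the triangular series by Gauss's identity. *)
Lemma euler_quartic : eqX N (2 * e 1 ^+ 14) (e 2 ^+ 4 * Q).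
Proof.
pose J := theta N (fun k => (-1) ^+ k * (2 * k%:R + 1)).
apply: (@eqX_trans _ _ (2 * J ^+ 4 * e 1 ^+ 2)).
  have -> : 2 * e 1 ^+ 14 = 2 * (e 1 ^+ 3) ^+ 4 * e 1 ^+ 2 by ring.
  apply: eqX_mul => //; apply: eqX_mul => //; apply: eqX_exp; exact: jacobi_cube.
apply: (@eqX_trans _ _ (T 0 ^+ 2 * Q * e 1 ^+ 2)).
  by apply: eqX_mul => //; apply: theta_quartic.
have -> : T 0 ^+ 2 * Q * e 1 ^+ 2 = (e 1 * T 0) ^+ 2 * Q by ring.
have -> : e 2 ^+ 4 * Q = (e 2 ^+ 2) ^+ 2 * Q by ring.
by apply: eqX_mul => //; apply: eqX_exp; apply: gauss_triangular.
Qed.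

(** Changing the sign of q affects only the factors of odd index, and (1 + q^j) (1 - q^j) = 1 - q^(2
    j). *)
Lemma flipX_euler : eqX N (flipX (e 1) * e 1 * e 4) (e 2 ^+ 3).
Proof.
have st d : (0 < d)%N -> eqX N (e d) (euler_trunc d N.*2).
  by move=> d0; apply: euler_trunc_stable => //; lia.
apply: (@eqX_trans _ _ (flipX (euler_trunc 1 N.*2) * euler_trunc 1 N.*2 * e 4)).
  by apply: eqX_mul => //; apply: eqX_mul; [apply: eqX_flipX|]; apply: st.
apply: (@eqX_trans _ _ (e 2 ^+ 2 * euler_trunc 2 N.*2)); last first.
  by rewrite [e 2 ^+ 3]exprSr; apply: eqX_mul => //; apply: eqX_sym; apply: st.
apply: eqX_eq; rewrite !euler_trunc_odd_even flipXM.
have -> : flipX (euler_trunc (2 * 1) N) = e 2.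
  rewrite euler_truncE flipX_prod; apply: eq_bigr => i _.
  by rewrite flipX_1subXn -signr_odd -mulnA mul2n odd_double expr0 mul1r.
have -> : flipX (\prod_(i < N) (1 - 'X^(1 * i.*2.+1))) =
   \prod_(i < N) (1 + 'X^(i.*2.+1)).
  rewrite flipX_prod; apply: eq_bigr => i _.
  by rewrite flipX_1subXn -signr_odd mul1n /= odd_double expr1 mulN1r opprK.
have -> : \prod_(i < N) (1 - 'X^(2 * i.*2.+1)) =
   (\prod_(i < N) (1 + 'X^(i.*2.+1))) * (\prod_(i < N) (1 - 'X^(1 * i.*2.+1))) :> {poly int}.
  rewrite -big_split; apply: eq_bigr => i _ /=.
  by rewrite mul1n mulnC exprM; ring.
by rewrite muln1; ring.
Qed.

(** This is [euler_quartic] after q -> -q, with [flipX_euler] eliminating the flipped Euler product;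
    both sides are first multiplied by e2^4. *)
Lemma euler_quotient : eqX N (2 * e 2 ^+ 38) (flipX Q * e 1 ^+ 14 * e 4 ^+ 14).
Proof.
apply: (@eqX_mulI _ (e 2 ^+ 4)); first by rewrite coef0_expr ?euler_trunc0.
apply: (@eqX_trans _ _ (2 * (e 2 ^+ 3) ^+ 14)); first by apply: eqX_eq; ring.
apply: (@eqX_trans _ _ (2 * (flipX (e 1) * e 1 * e 4) ^+ 14)).
  by apply: eqX_mul => //; apply: eqX_exp; apply/eqX_sym/flipX_euler.
apply: (@eqX_trans _ _ (flipX (e 2 ^+ 4 * Q) * (e 1 * e 4) ^+ 14)); last first.
  rewrite flipXM flipX_exp; apply: eqX_eq.
  have -> : flipX (e 2) = e 2.
    rewrite euler_truncE flipX_prod; apply: eq_bigr => i _.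
    by rewrite flipX_1subXn -signr_odd mul2n odd_double expr0 mul1r.
  by ring.
apply: (@eqX_trans _ _ (flipX (2 * e 1 ^+ 14) * (e 1 * e 4) ^+ 14)).
  apply: eqX_eq; rewrite flipXM flipX_exp.
  by rewrite [flipX 2](_ : _ = 2) ?flipX_nat //; ring.
by apply: eqX_mul => //; apply/eqX_flipX/euler_quartic.
Qed.

Lemma comp_X4_euler d : (euler_trunc d N) \Po 'X^4 = euler_trunc (4 * d) N.
Proof.
rewrite !euler_truncE rmorph_prod; apply: eq_bigr => i _ /=.
by rewrite comp_polyB -polyC1 comp_polyC comp_Xn_poly -exprM mulnA.
Qed.

Lemma eqX_comp_X4 P R : eqX N P R -> eqX N (P \Po 'X^4) (R \Po 'X^4).
Proof.
move=> h i le; rewrite !coef_comp_poly_Xn //; case: ifP => // _; apply: h.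
by apply: leq_trans le; apply: leq_div.
Qed.

(** Substituting q^4 for q in [euler_quotient] and comparing with the eta quotient gives 2 g_2 = q
    Q(-q^4). *)
Lemma c_g2_theta m : (4 * m + 1 <= N)%N -> 2 * c_g2 (4 * m + 1) = (-1) ^+ m * Q`_m.
Proof.
move=> mN; rewrite -coef_flipX.
have compX4_exp (P : {poly int}) k : (P ^+ k) \Po 'X^4 = (P \Po 'X^4) ^+ k.
  exact: rmorphXn.
have compX4_2 : (2 : {poly int}) \Po 'X^4 = 2 by apply: rmorph_nat.
have h : eqX N (2 * (\poly_(n < N.+1) c_g2 n)) ('X * (flipX Q \Po 'X^4)).
  apply: (@eqX_mulI _ (e 4 ^+ 14 * e 16 ^+ 14)).
    by rewrite coef0_mul ?coef0_expr ?euler_trunc0.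
  apply: (@eqX_trans _ _ (2 * ((\poly_(n < N.+1) c_g2 n) * e 4 ^+ 14 * e 16 ^+ 14))).
    by apply: eqX_eq; ring.
  apply: (@eqX_trans _ _ (2 * ('X * e 8 ^+ 38))).
    by apply: eqX_mul => //; apply: c_g2_eta_quotient.
  apply: (@eqX_trans _ _ ('X * ((2 * e 2 ^+ 38) \Po 'X^4))).
    apply: eqX_eq; rewrite comp_polyM compX4_exp comp_X4_euler compX4_2.
    by ring.
  apply: (@eqX_trans _ _ ('X * ((flipX Q * e 1 ^+ 14 * e 4 ^+ 14) \Po 'X^4))).
    by apply: eqX_mul => //; apply/eqX_comp_X4/euler_quotient.
  apply: eqX_eq; rewrite comp_polyM [(flipX Q * _) \Po _]comp_polyM.
  rewrite !compX4_exp !comp_X4_euler.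
  by ring.
have := h _ mN; rewrite coefXM addn1 /= coef_comp_poly_Xn // dvdn_mulr // mulKn // => <-.
by rewrite -polyC_natr coefCM coef_poly -[(4 * m).+1]addn1 ltnS mN natz.
Qed.

Lemma coef_thetaM u v i : (theta N u * theta N v)`_i =
  \sum_(j < N.+1) \sum_(k < N.+1 | (tri j + tri k == i)%N) u j * v k.
Proof.
rewrite /theta big_distrlr /= coef_sum; apply: eq_bigr => j _.
rewrite coef_sum [RHS]big_mkcond; apply: eq_bigr => k _ /=.
rewrite -scalerAl -scalerAr -exprD !coefZ coefXn eq_sym.
by case: ifP => _; rewrite ?mulr1 ?mulr0 // mulr0.
Qed.

Lemma c_g2_double_sum m : (4 * m + 1 <= N)%N -> 2 * c_g2 (4 * m + 1) =
  (-1) ^+ m * \sum_(j < N.+1) \sum_(k < N.+1 | (tri j + tri k == m)%N)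
    (3 * (2 * j%:R + 1) ^+ 2 * (2 * k%:R + 1) ^+ 2 - (2 * j%:R + 1) ^+ 4).
Proof.
move=> mN; rewrite c_g2_theta //; congr (_ * _).
rewrite /Q coefB -polyC_natr coefCM expr2 !coef_thetaM mulr_sumr -sumrB.
apply: eq_bigr => j _; rewrite mulr_sumr -sumrB; apply: eq_bigr => k _.
by rewrite expr0 mulr1 mulrA.
Qed.

End EtaQuotient.

(** * Sums of two odd squares *)

Definition odd_reps (n : nat) : seq (nat * nat) :=
  [seq u <- [seq (x, y) | x <- iota 0 n.*2.+1, y <- iota 0 n.*2.+1] |
    [&& odd u.1, odd u.2 & u.1 ^ 2 + u.2 ^ 2 == n.*2]%N].

Lemma mem_odd_reps n u :
  (u \in odd_reps n) = [&& odd u.1, odd u.2 & u.1 ^ 2 + u.2 ^ 2 == n.*2]%N.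
Proof.
rewrite mem_filter; apply: andb_idr => /and3P [o1 o2 /eqP e].
rewrite [u]surjective_pairing; apply: allpairs_f; rewrite mem_iota add0n ltnS -e.
  by apply: leq_trans (leq_addr _ _); rewrite -mulnn; case: (u.1) => // k; rewrite leq_pmulr.
by apply: leq_trans (leq_addl _ _); rewrite -mulnn; case: (u.2) => // k; rewrite leq_pmulr.
Qed.

Lemma uniq_odd_reps n : uniq (odd_reps n).
Proof.
apply: filter_uniq; apply: allpairs_uniq; rewrite ?iota_uniq //.
by move=> [? ?] [? ?] _ _ /= [-> ->].
Qed.

(** Symmetrized in x and y this is 6 x^2 y^2 - x^4 - y^4 = - Re (x + i y)^4. *)
Definition quartic (u : nat * nat) : int := 3 * u.1%:R ^+ 2 * u.2%:R ^+ 2 - u.1%:R ^+ 4.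

Lemma c_g2_odd_reps m :
  2 * c_g2 (4 * m + 1) = (-1) ^+ m * \sum_(u <- odd_reps (4 * m + 1)) quartic u.
Proof.
rewrite (c_g2_double_sum (leqnn _)); congr (_ * _).
set K := (4 * m + 1).+1.
pose s := [seq u <- [seq (j, k) | j <- iota 0 K, k <- iota 0 K] | tri u.1 + tri u.2 == m]%N.
transitivity (\sum_(u <- s) quartic (u.1.*2.+1, u.2.*2.+1)).
  rewrite /s big_filter [RHS]big_mkcond big_allpairs -[iota 0 K]/(index_iota 0 K) big_mkord.
  apply: eq_bigr => j _; rewrite big_mkord big_mkcond; apply: eq_bigr => k _ /=.
  by case: ifP => // _; rewrite /quartic /= -!natr1 -!muln2 !natrM ![_%:R * 2%:R]mulrC.
rewrite -(big_map (fun u : nat * nat => (u.1.*2.+1, u.2.*2.+1)) xpredT quartic).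
apply: perm_big; apply: uniq_perm; last 1 first.
- move=> [x y]; rewrite mem_odd_reps /=; apply/mapP/and3P.
    move=> [[j k]]; rewrite mem_filter /= => /andP [/eqP e _] [-> ->].
    rewrite /= !odd_double; split=> //; apply/eqP.
    by have := tri_double j; have := tri_double k; rewrite -!mulnn; lia.
  move=> [ox oy /eqP e]; exists (x./2, y./2); last by rewrite /=; congr (_, _); lia.
  have ex : x = x./2.*2.+1 by lia.
  have ey : y = y./2.*2.+1 by lia.
  have et : (tri x./2 + tri y./2 = m)%N.
    have := tri_double x./2; have := tri_double y./2.
    by move: e; rewrite {1}ex {1}ey -!mulnn; move: (x./2) (y./2) => j k; lia.
  rewrite mem_filter; apply/andP; split; first by rewrite /= et.
  apply: allpairs_f; rewrite mem_iota add0n /K.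
    by have := leq_tri x./2; lia.
  by have := leq_tri y./2; lia.
- rewrite map_inj_uniq; last by move=> [a b] [c d] /= [/double_inj -> /double_inj ->].
  apply: filter_uniq; apply: allpairs_uniq; rewrite ?iota_uniq //.
  by move=> [? ?] [? ?] _ _ /= [-> ->].
exact: uniq_odd_reps.
Qed.

(** Otherwise b^2 = -a^2 with a, b nonzero modulo p; raising to the odd power (p - 1) / 2 gives 1 =
    -1 by Fermat. *)
Lemma dvdn_sum_sqr p x y : prime p -> p = 3 %[mod 4] -> (p %| x ^ 2 + y ^ 2)%N -> (p %| x)%N.
Proof.
move=> pp p3; have pch := pchar_Fp pp; rewrite !(dvdn_pcharf pch) natrD !natrX.
set a : 'F_p := x%:R; set b : 'F_p := y%:R => h.
apply/negPn/negP => a0.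
have eb : b ^+ 2 = - a ^+ 2 by apply/eqP; rewrite -addr_eq0 addrC.
have b0 : b != 0 by apply: contraNneq a0 => b0; rewrite -sqrf_eq0 -oppr_eq0 -eb b0 expr0n.
have [k kE] : exists k, p = (4 * k + 3)%N by exists (p %/ 4)%N; rewrite {1}(divn_eq p 4) p3; lia.
have fermat (c : 'F_p) : c != 0 -> c ^+ 2 ^+ (2 * k + 1) = 1.
  move=> c0; rewrite -exprM; apply: (mulfI c0); rewrite -exprS mulr1.
  by rewrite -[RHS](expf_card c) card_Fp //; congr (_ ^+ _); lia.
have := fermat b b0; rewrite eb exprNn fermat // mulr1 -signr_odd.
rewrite oddD oddM /= expr1 => /eqP; rewrite eq_sym -subr_eq0 opprK -mulr2n.
rewrite -(dvdn_pcharf pch) => /dvdn_leq; rewrite kE; lia.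
Qed.

(** Brahmagupta's identity writes n^2 as (c y - d x)^2 + (c x + d y)^2 and as (c y + d x)^2 + (c x -
    d y)^2. By positivity, a multiple of n in first place must be 0 in the one case and n in the
    other. *)
Lemma sum_two_sqr_unique (n c d x y : int) : 0 < c -> 0 < d -> 0 < x -> 0 < y ->
  c ^+ 2 + d ^+ 2 = n -> x ^+ 2 + y ^+ 2 = n ->
  ((n %| c * y - d * x) || (n %| c * y + d * x))%Z -> (x = c /\ y = d) \/ (x = d /\ y = c).
Proof.
move=> c0 d0 x0 y0 ecd exy.
have n0 : 0 < n by rewrite -ecd addr_gt0 // exprn_gt0.
have sqr_inj (a b : int) : 0 < a -> 0 < b -> a ^+ 2 = b ^+ 2 -> a = b by move=> *; nia.
have n2 : n * n = (c ^+ 2 + d ^+ 2) * (x ^+ 2 + y ^+ 2) by rewrite ecd exy.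
case/orP => /dvdzP [k hk].
  left; have W0 : 0 < c * x + d * y by rewrite addr_gt0 // mulr_gt0.
  have e : (k * k) * (n * n) + (c * x + d * y) ^+ 2 = n * n.
    by rewrite mulrACA -hk n2; ring.
  have k0 : k = 0.
    apply/eqP/negPn/negP => k0; have : 1 <= k * k by nia.
    have : 0 < n * n by rewrite mulr_gt0.
    have : 0 < (c * x + d * y) ^+ 2 by rewrite exprn_gt0.
    move: e; move: (k * k) (n * n) ((c * x + d * y) ^+ 2) => K M W; nia.
  have xc : x = c.
    apply: sqr_inj => //; apply: (mulfI (lt0r_neq0 n0)).
    transitivity (c ^+ 2 * x ^+ 2 + (d * x) ^+ 2); first by rewrite -ecd; ring.
    have -> : d * x = c * y by move: hk; rewrite k0 mul0r; lia.
    by rewrite -exy; ring.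
  split=> //; apply: sqr_inj => //; move: ecd; rewrite -exy xc; lia.
right; have V0 : 0 < c * y + d * x by rewrite addr_gt0 // mulr_gt0.
have e : (k * k) * (n * n) + (c * x - d * y) ^+ 2 = n * n.
  by rewrite mulrACA -hk n2; ring.
have k1 : k = 1.
  have k0 : 0 < k by move: V0; rewrite hk pmulr_lgt0.
  apply/eqP/negPn/negP => k1; have : 4 <= k * k by nia.
  have : 0 < n * n by rewrite mulr_gt0.
  have : 0 <= (c * x - d * y) ^+ 2 by rewrite sqr_ge0.
  move: e; move: (k * k) (n * n) ((c * x - d * y) ^+ 2) => K M W; nia.
have h : c * x = d * y.
  apply/eqP; rewrite -subr_eq0 -sqrf_eq0; apply/eqP.
  by move: e; rewrite k1 !mul1r => /(canRL (addKr _)); rewrite addNr.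
have xd : x = d.
  apply: sqr_inj => //; apply: (mulfI (lt0r_neq0 n0)).
  transitivity ((c * x) ^+ 2 + d ^+ 2 * x ^+ 2); first by rewrite -ecd; ring.
  by rewrite h -exy; ring.
by split=> //; apply: sqr_inj => //; move: ecd; rewrite -exy xd; lia.
Qed.

(** The product of c y - d x and c y + d x is divisible by 2 p^r. As p cannot divide both, their sum
    being 2 c y, one of them takes all of p^r, and both are even; [sum_two_sqr_unique] concludes. *)
Lemma odd_reps_primitive p r c d : prime p -> odd p -> (0 < r)%N -> odd c -> odd d ->
  (c ^ 2 + d ^ 2 = (p ^ r).*2)%N -> ~~ (p %| c)%N ->
  perm_eq [seq u <- odd_reps (p ^ r) | ~~ (p %| u.1)%N] [:: (c, d); (d, c)].
Proof.
move=> pp po r0 oc od e pc.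
have dvd x y : (x ^ 2 + y ^ 2 = (p ^ r).*2)%N -> (p %| x)%N = (p %| y)%N.
  move=> h; have : (p %| x ^ 2 + y ^ 2)%N.
    by rewrite h -(prednK r0) expnS -mul2n mulnCA dvdn_mulr.
  move=> h2; apply/idP/idP => h3; move: h2.
    by rewrite dvdn_addr ?Euclid_dvdX ?h3 // => /andP [].
  by rewrite dvdn_addl ?Euclid_dvdX ?h3 // => /andP [].
have pd : ~~ (p %| d)%N by rewrite -(dvd _ _ e).
have p0 := prime_gt0 pp.
have cd : c != d.
  apply/eqP => cd; move: e; rewrite -cd addnn => /double_inj e2.
  have := Euclid_dvdX c 2 pp; rewrite (negPf pc) /= e2 -(prednK r0) expnS.
  by rewrite dvdn_mulr.
apply: uniq_perm; first by rewrite filter_uniq ?uniq_odd_reps.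
  by rewrite /= inE xpair_eqE negb_and cd.
move=> [x y]; rewrite mem_filter mem_odd_reps !inE /= !xpair_eqE.
apply/idP/idP; last first.
  case/orP => /andP [/eqP -> /eqP ->]; first by rewrite pc oc od e eqxx.
  by rewrite pd od oc addnC e eqxx.
case/and4P => px ox oy /eqP exy.
have cop (U V : int) : ~~ (p%:Z %| V)%Z -> (2 %| U)%Z -> (((p ^ r).*2)%:Z %| U * V)%Z ->
    (((p ^ r).*2)%:Z %| U)%Z.
  move=> pV U2 h; rewrite -mul2n PoszM Gauss_dvdz; last first.
    by rewrite coprimezE; apply: coprimeXr; rewrite coprime2n.
  rewrite U2 /= -(@Gauss_dvdzl _ _ V).
    by apply: dvdz_trans h; rewrite -mul2n PoszM dvdz_mull.
  rewrite coprimezE absz_nat; apply: coprimeXl; rewrite prime_coprime //.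
have toZ (a b : nat) : (a ^ 2 + b ^ 2)%N%:Z = a%:Z ^+ 2 + b%:Z ^+ 2.
  by rewrite PoszD -!mulnn !PoszM -!expr2.
have ecdZ : c%:Z ^+ 2 + d%:Z ^+ 2 = ((p ^ r).*2)%:Z by rewrite -toZ e.
have exyZ : x%:Z ^+ 2 + y%:Z ^+ 2 = ((p ^ r).*2)%:Z by rewrite -toZ exy.
have h := @sum_two_sqr_unique ((p ^ r).*2)%:Z c%:Z d%:Z x%:Z y%:Z.
have : (x%:Z = c%:Z /\ y%:Z = d%:Z) \/ (x%:Z = d%:Z /\ y%:Z = c%:Z).
  apply: h; rewrite ?ltz_nat ?odd_gt0 //.
  have UV : (((p ^ r).*2)%:Z %| (c%:Z * y%:Z - d%:Z * x%:Z) * (c%:Z * y%:Z + d%:Z * x%:Z))%Z.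
    apply/dvdzP; exists (c%:Z ^+ 2 - x%:Z ^+ 2).
    transitivity (c%:Z ^+ 2 * (x%:Z ^+ 2 + y%:Z ^+ 2) - (c%:Z ^+ 2 + d%:Z ^+ 2) * x%:Z ^+ 2).
      by ring.
    by rewrite exyZ ecdZ; ring.
  have V2 : (2 %| c%:Z * y%:Z + d%:Z * x%:Z)%Z.
    by rewrite -!PoszM -PoszD dvdzE /= dvdn2 oddD !oddM oc od ox oy.
  have U2 : (2 %| c%:Z * y%:Z - d%:Z * x%:Z)%Z.
    have -> : c%:Z * y%:Z - d%:Z * x%:Z = (c%:Z * y%:Z + d%:Z * x%:Z) - 2 * (d%:Z * x%:Z).
      by ring.
    by rewrite rpredB // dvdz_mulr ?dvdzz.
  have [pV|pV] := boolP (p%:Z %| c%:Z * y%:Z + d%:Z * x%:Z)%Z.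
    apply/orP; right; apply: (cop _ (c%:Z * y%:Z - d%:Z * x%:Z)) => //; last by rewrite mulrC.
    apply/negP => pU; have := rpredD pU pV.
    have -> : c%:Z * y%:Z - d%:Z * x%:Z + (c%:Z * y%:Z + d%:Z * x%:Z) = (2 * c * y)%N%:Z.
      by rewrite !PoszM; ring.
    rewrite dvdzE /= !Euclid_dvdM // (negPf pc) -(dvd _ _ exy) (negPf px) !orbF.
    by rewrite gtnNdvd // odd_prime_gt2.
  by apply/orP; left; apply: cop pV _ UV.
by case=> [] [[->] [->]]; rewrite !eqxx ?orbT.
Qed.

Lemma odd_reps_imprimitive p r : prime p -> odd p ->
  perm_eq [seq u <- odd_reps (p ^ r.+2) | (p %| u.1)%N]
          [seq (p * u.1, p * u.2)%N | u <- odd_reps (p ^ r)].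
Proof.
move=> pp po; have p0 := prime_gt0 pp.
apply: uniq_perm; first by rewrite filter_uniq ?uniq_odd_reps.
  rewrite map_inj_uniq ?uniq_odd_reps // => -[a b] [c d] /= [] /eqP + /eqP.
  by rewrite !eqn_pmul2l // => /eqP -> /eqP ->.
have sc x y : ((p * x) ^ 2 + (p * y) ^ 2 == (p ^ r.+2).*2)%N = (x ^ 2 + y ^ 2 == (p ^ r).*2)%N.
  rewrite !expnMn -mulnDr -[r.+2]addn2 expnD doubleMl mulnC.
  by rewrite eqn_pmul2r // expn_gt0 p0.
move=> [x y]; apply/idP/mapP.
  rewrite mem_filter mem_odd_reps /= => /and4P [/dvdnP [x' xE] ox oy /eqP e].
  have : (p %| y ^ 2)%N.
    rewrite -(@dvdn_addr (x ^ 2)) ?xE ?expnMn; last by rewrite dvdn_mull // dvdn_exp.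
    by rewrite -expnMn -xE e -mul2n expnS mulnCA dvdn_mulr.
  rewrite Euclid_dvdX // => /andP [/dvdnP [y' yE] _].
  exists (x', y') => /=; last by rewrite xE yE ![(_ * p)%N]mulnC.
  rewrite mem_odd_reps /= -sc; move: ox oy e; rewrite xE yE !oddM po !andbT.
  by rewrite ![(_ * p)%N]mulnC => -> -> ->; rewrite eqxx.
move=> [[x' y']]; rewrite mem_odd_reps /= => /and3P [ox oy e] [-> ->].
by rewrite mem_filter mem_odd_reps /= dvdn_mulr // !oddM po ox oy sc.
Qed.

(** The two primitive pairs contribute 6 c^2 d^2 - c^4 - d^4 = 8 c^2 d^2 - (c^2 + d^2)^2; the others
    are p times the pairs for p^(r - 2). *)
Lemma sum_quartic_primitive p r c d : prime p -> odd p -> (0 < r)%N -> odd c -> odd d ->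
  (c ^ 2 + d ^ 2 = (p ^ r).*2)%N -> ~~ (p %| c)%N ->
  \sum_(u <- odd_reps (p ^ r)) quartic u =
  8 * c%:R ^+ 2 * d%:R ^+ 2 - 4 * p%:R ^+ r ^+ 2 +
  if (r < 2)%N then 0 else p%:R ^+ 4 * \sum_(u <- odd_reps (p ^ (r - 2))) quartic u.
Proof.
move=> pp po r0 oc od e pc.
rewrite (bigID (fun u => p %| u.1)%N) /= addrC -big_filter -[X in _ + X]big_filter.
congr (_ + _).
  rewrite (perm_big _ (odd_reps_primitive pp po r0 oc od e pc)) /= !big_cons big_nil.
  have : (c%:R ^+ 2 + d%:R ^+ 2 = 2 * p%:R ^+ r :> int).
    by rewrite -!natrX -natrD e -muln2 natrM mulrC.
  rewrite /quartic /=; move: (c%:R) (d%:R) (p%:R ^+ r) => C D P h.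
  have -> : 4 * P ^+ 2 = (C ^+ 2 + D ^+ 2) ^+ 2 by rewrite h; ring.
  by ring.
case: ltnP => r2; last first.
  have -> : (p ^ r = p ^ (r - 2).+2)%N by congr (_ ^ _)%N; lia.
  rewrite (perm_big _ (odd_reps_imprimitive _ pp po)) big_map mulr_sumr /=.
  by apply: eq_bigr => u _; rewrite /quartic /= !natrM; ring.
(* For r = 1 a pair divisible by p would make p^2 divide 2 p. *)
have r1 : r = 1%N by lia.
rewrite r1 big_filter big_seq_cond big1 // => -[x y] /=.
rewrite mem_odd_reps /= expn1 => /andP [/and3P [ox oy /eqP exy] px]; exfalso.
have py : (p %| y ^ 2)%N.
  by rewrite -(@dvdn_addr (x ^ 2)) ?dvdn_exp // exy -mul2n dvdn_mull.
have : (p ^ 2 %| p.*2)%N.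
  rewrite -exy dvdn_add // dvdn_exp2r //.
  by move: py; rewrite Euclid_dvdX // => /andP [].
rewrite -mulnn -mul2n dvdn_pmul2r ?prime_gt0 //.
by rewrite gtnNdvd // odd_prime_gt2.
Qed.

(** * Quadratic symbols *)

Lemma jacobi_prime_pow a p r : prime p -> (0 < r)%N ->
  jacobi_symbol a (p ^ r) = legendre_symbol a p ^+ r.
Proof.
move=> pp r0; rewrite /jacobi_symbol prime_decompE primesX // primes_prime //=.
by rewrite big_seq1 /= pfactorK.
Qed.

Lemma legendre_qchar a p : prime p -> odd p ->
  legendre_symbol a p = @qchar 'F_p a%:~R.
Proof.
move=> pp po; have pch := pchar_Fp pp; have p0 := prime_gt0 pp.
have oddF : odd #|'F_p| by rewrite card_Fp.
rewrite /legendre_symbol (dvdz_pcharf pch).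
have [->|a0] := eqVneq (a%:~R : 'F_p) 0; first by rewrite qchar0.
have eqF (x : nat) : (x%:Z ^+ 2 == a %[mod p])%Z = ((x%:R : 'F_p) ^+ 2 == a%:~R).
  by rewrite eqz_mod_dvd (dvdz_pcharf pch) rmorphB rmorphXn /= subr_eq0.
have cardS := sqrt_card oddF (a%:~R : 'F_p).
have q1 : qchar (a%:~R : 'F_p) ^+ 2 = 1 by rewrite sqr_qchar a0.
case: ifP => [/existsP [x hx]|/existsPn h].
  have : (0 < #|[set y : 'F_p | y ^+ 2 == a%:~R]|)%N.
    by apply/card_gt0P; exists (x%:R); rewrite inE -eqF.
  move/eqP: q1; rewrite sqrf_eq1 => /orP [] /eqP e //.
  by move: cardS; rewrite e subrr => -[->].
move: cardS; rewrite (_ : [set _ | _] = set0) ?cards0.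
  by move=> /eqP; rewrite eq_sym addr_eq0 => /eqP e; rewrite -[RHS]opprK -e.
apply/setP => y; rewrite !inE; apply/negP => /eqP ey.
case/negP: (h (Ordinal (ltn_pmod y p0))); rewrite eqF /=.
suff -> : ((y %% p)%:R : 'F_p) = y by rewrite ey.
by rewrite -[RHS]natr_Zp [in RHS](divn_eq y p) natrD natrM (pcharf0 pch) mulr0 add0r.
Qed.

Lemma legendreN1_1mod4 p : prime p -> p = 1 %[mod 4] -> legendre_symbol (-1) p = 1.
Proof.
move=> pp p1; have po : odd p by lia.
rewrite legendre_qchar // rmorphN1 qcharN1 ?card_Fp //.
by have -> : odd p.-1./2 = false by lia.
Qed.

Lemma legendreN1_3mod4 p : prime p -> p = 3 %[mod 4] -> legendre_symbol (-1) p = -1.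
Proof.
move=> pp p1; have po : odd p by lia.
rewrite legendre_qchar // rmorphN1 qcharN1 ?card_Fp //.
by have -> : odd p.-1./2 by lia.
Qed.

(* [2 = - i (1 + i)^2] for a square root [i] of [-1], so 2 is a square if and
   only if [i] is. *)
Lemma legendre2_1mod4 k : prime (4 * k + 1) -> legendre_symbol 2 (4 * k + 1) = (-1) ^+ k.
Proof.
set p := (4 * k + 1)%N => pp; have po : odd p by rewrite /p; lia.
have oddF : odd #|'F_p| by rewrite card_Fp.
have N1 : qchar (-1 : 'F_p) = 1.
  rewrite qcharN1 ?card_Fp //.
  by have -> : odd p.-1./2 = false by rewrite /p; lia.
have [i hi] : exists i : 'F_p, i ^+ 2 = -1.
  have := sqrt_card oddF (-1); rewrite N1.
  case: (set_0Vmem [set y : 'F_p | y ^+ 2 == -1]) => [->|[i]]; first by rewrite cards0.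
  by rewrite inE => /eqP; exists i.
have i0 : i != 0.
  apply/eqP => i0; move: hi; rewrite i0 expr0n /= => /eqP.
  by rewrite eq_sym oppr_eq0 oner_eq0.
have i10 : 1 + i != 0.
  apply/eqP => /eqP; rewrite addrC addr_eq0 => /eqP e; move: hi; rewrite e sqrrN expr1n.
  by move/eqP; rewrite (negPf (oner_neqN1 oddF)).
rewrite legendre_qchar //.
have -> : (2%:~R : 'F_p) = (1 + i) ^+ 2 * - i.
  by transitivity (- i - 2 * i ^+ 2 - i * i ^+ 2); [rewrite hi|]; ring.
rewrite qcharMsq // qcharN //.
have e : (qchar i)%:~R = ((-1) ^+ k)%:~R :> 'F_p.
  rewrite qchar_intr // card_Fp //.
  have -> : (p.-1./2 = 2 * k)%N by rewrite /p; lia.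
  by rewrite exprM hi rmorphXn rmorphN1.
have : qchar i ^+ 2 = 1 by rewrite sqr_qchar i0.
move/eqP; rewrite sqrf_eq1 => /orP [] /eqP hq; rewrite hq in e *;
  move: e; rewrite -signr_odd; case: (odd k) => //= /eqP;
  rewrite ?(expr0, expr1) ?rmorphN1 ?rmorph1 ?(negPf (oner_neqN1 oddF)) //.
by rewrite eq_sym (negPf (oner_neqN1 oddF)).
Qed.

(** Links the sign (-1)^m in the formula for [c_g2] with the symbol of 2 modulo p^r. *)
Lemma prime_pow_1mod4 k r : exists m, ((4 * k + 1) ^ r = 4 * m + 1)%N /\
  (-1) ^+ m = (-1) ^+ (k * r) :> int.
Proof.
elim: r => [|r [m [e s]]]; first by exists 0%N; rewrite !muln0.
exists ((4 * m + 1) * k + m)%N; split; first by rewrite expnS e; nia.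
by rewrite exprD s mulnS exprD -signr_odd oddM oddD oddM /= signr_odd.
Qed.

Lemma qcharN1_1mod4 (F : finFieldType) m : #|F| = (4 * m + 1)%N -> qchar (-1 : F) = 1.
Proof.
move=> cF; have oddF : odd #|F| by rewrite cF; lia.
rewrite qcharN1 // cF.
by have -> : odd (4 * m + 1).-1./2 = false by lia.
Qed.

Lemma third_moment_3mod4 (F : finFieldType) : #|F| = 3 %[mod 4] -> S_Leg F 3 = 0.
Proof.
move=> cF; have oddF : odd #|F| by lia.
have N1 : qchar (-1 : F) = -1.
  rewrite qcharN1 //; have -> // : odd #|F|.-1./2.
  by move: cF; move: #|F| => n; lia.
have refl (l : F) : @leg_tr F (1 - l) = - leg_tr l.
  rewrite !leg_trE // (reindex_inj (h := fun x : F => 1 - x)) /=; last first.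
    by move=> x y /addrI/oppr_inj.
  congr (- _); rewrite -sumrN; apply: eq_bigr => x _.
  by rewrite -[RHS]mulN1r -N1 -qcharM //; congr qchar; ring.
have : S_Leg F 3 = - S_Leg F 3.
  rewrite {1}/S_Leg (reindex_inj (h := fun x : F => 1 - x)) /=; last first.
    by move=> x y /addrI/oppr_inj.
  by rewrite -sumrN; apply: eq_bigr => l _; rewrite refl exprNn -signr_odd mulN1r.
by move/eqP; rewrite -addr_eq0 -mulr2n mulrn_eq0 /= => /eqP.
Qed.

(** Descent on s: p divides both coordinates, so p^2 can be cancelled until only 1 + 1 = 2 is
    left. *)
Lemma odd_reps_3mod4 p s u : prime p -> p = 3 %[mod 4] ->
  (u \in odd_reps (p ^ (2 * s))) = (u == (p ^ s, p ^ s)%N).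
Proof.
move=> pp p3; have p0 := prime_gt0 pp; have po : odd p by lia.
case: u => x y; rewrite mem_odd_reps xpair_eqE /=; apply/idP/idP; last first.
  by case/andP => /eqP -> /eqP ->; rewrite !oddX po orbT addnn -expnM mulnC eqxx.
case/and3P => ox oy /eqP e; elim: s x y ox oy e => [|s IH] x y ox oy.
  rewrite muln0 !expn0 -!mulnn; case: x ox => [|[|x]] //; case: y oy => [|[|y]] //; lia.
rewrite mulnS => e.
have h : (p %| x ^ 2 + y ^ 2)%N by rewrite e -mul2n expnS mulnCA dvdn_mulr.
have /dvdnP [x' xE] := dvdn_sum_sqr pp p3 h.
have /dvdnP [y' yE] : (p %| y)%N by apply: dvdn_sum_sqr pp p3 _; rewrite addnC; apply: h.
move: ox oy e; rewrite xE yE !oddM po !andbT => ox oy.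
rewrite expnD !expnMn -mulnDl doubleMr mulnC => /eqP.
rewrite eqn_pmul2l ?expn_gt0 ?p0 // => /eqP /(IH _ _ ox oy) /andP [/eqP -> /eqP ->].
by rewrite !expnSr eqxx.
Qed.

(** * The values of E_3 *)

Lemma odd_of_sum_sqr n x y : odd n -> (x ^ 2 + y ^ 2 = n.*2)%N -> odd x /\ odd y.
Proof.
move=> on; have -> : n = n./2.*2.+1 by lia.
have xE := odd_double_half x; have yE := odd_double_half y.
rewrite -{1}xE -{1}yE -!mulnn; case: (odd x); case: (odd y) => //= h; split=> //; nia.
Qed.

(** The symbol of 2 cancels the sign of the eta coefficients, and the term with p^(r - 2) removes
    exactly the imprimitive pairs. *)
Lemma E3_1mod4 p r c d : prime p -> p = 1 %[mod 4] -> (0 < r)%N -> odd c -> odd d ->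
  (c ^ 2 + d ^ 2 = (p ^ r).*2)%N -> ~~ (p %| c)%N ->
  E3 p r = 2 * p%:R ^+ r ^+ 2 - 4 * c%:R ^+ 2 * d%:R ^+ 2.
Proof.
move=> pp p1 r0 oc od e pc; have po : odd p by lia.
have [k kE] : exists k, p = (4 * k + 1)%N by exists (p %/ 4)%N; lia.
have [m [em sm]] := prime_pow_1mod4 k r; rewrite -kE in em.
have J2 : jacobi_symbol 2 (p ^ r) = (-1) ^+ m.
  by rewrite jacobi_prime_pow // kE legendre2_1mod4 -?kE // -exprM sm.
have JN : jacobi_symbol (-1) p = 1.
  by rewrite -[p]expn1 jacobi_prime_pow // legendreN1_1mod4.
have A := sum_quartic_primitive pp po r0 oc od e pc.
have C := c_g2_odd_reps m; rewrite -em in C.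
(* The exponents r and r - 2 have the same parity, so both coefficients carry the same sign. *)
have C2 : 2 * c_g2_pow_sub2 p r = (-1) ^+ m *
    (if (r < 2)%N then 0 else \sum_(u <- odd_reps (p ^ (r - 2))) quartic u).
  rewrite /c_g2_pow_sub2; case: ltnP => r2; first by rewrite !mulr0.
  have [m' [em' sm']] := prime_pow_1mod4 k (r - 2); rewrite -kE in em'.
  have := c_g2_odd_reps m'; rewrite -em' sm' sm => ->; congr (_ * _).
  by rewrite -[LHS]signr_odd -[RHS]signr_odd !oddM oddB // addbF.
have s2 : (-1) ^+ m * (-1) ^+ m = 1 :> int by rewrite -expr2 sqrr_sign.
apply: (mulfI (isT : 2 != 0 :> int)); rewrite /E3 J2 JN mul1r.
move: A C C2 s2; rewrite -[p%:Z]natz.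
move: (\sum_(u <- odd_reps (p ^ r)) _) (c_g2 _) (c_g2_pow_sub2 _ _) ((-1) ^+ m).
move=> A B B' s; set D := (\sum_(u <- _) _) => hA hB hB' s2.
transitivity (- s * (2 * B - p%:R ^+ 4 * (2 * B'))); first by ring.
rewrite hB hB' hA.
transitivity (- (s * s) * (8 * c%:R ^+ 2 * d%:R ^+ 2 - 4 * p%:R ^+ r ^+ 2)).
  by case: (r < 2)%N; ring.
by rewrite s2; ring.
Qed.

(** Only the pair (p^s, p^s) contributes. The odd square p^(2 s) is 1 modulo 8, so the sign is
    +1. *)
Lemma c_g2_inert_pow p s : prime p -> p = 3 %[mod 4] ->
  c_g2 (p ^ (2 * s)) = p%:R ^+ (4 * s).
Proof.
move=> pp p3; have po : odd p by lia.
have [t tE] : exists t, (p ^ s = t.*2.+1)%N.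
  by exists (p ^ s)./2; have := odd_double_half (p ^ s); rewrite oddX po orbT; lia.
have [m mE] : exists m, (t * t.+1 = m.*2)%N.
  exists (t * t.+1)./2; have := odd_double_half (t * t.+1).
  by rewrite oddM /= andbN; lia.
have nE : (p ^ (2 * s) = 4 * m.*2 + 1)%N.
  by rewrite mulnC expnM tE -mulnn; lia.
have := c_g2_odd_reps m.*2; rewrite -nE -signr_odd odd_double mul1r.
have : perm_eq (odd_reps (p ^ (2 * s))) [:: (p ^ s, p ^ s)%N].
  apply: uniq_perm; rewrite ?uniq_odd_reps // => u.
  by rewrite odd_reps_3mod4 // inE.
move/(perm_big _) => ->; rewrite big_seq1 /quartic /= !natrX => e.
apply: (mulfI (isT : 2 != 0 :> int)); rewrite e mulnC [in RHS]exprM.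
by ring.
Qed.

Lemma E3_3mod4 p s : prime p -> p = 3 %[mod 4] ->
  E3 p (2 * s.+1) = - 2 * p%:R ^+ (4 * s.+1).
Proof.
move=> pp p3; have po : odd p by lia.
have r0 : (0 < 2 * s.+1)%N by rewrite muln_gt0.
rewrite /E3; have -> : jacobi_symbol 2 (p ^ (2 * s.+1)) = 1.
  rewrite jacobi_prime_pow // exprM legendre_qchar // sqr_qchar.
  suff -> : (2%:~R : 'F_p) != 0 by rewrite expr1n.
  by apply: two_neq0; rewrite card_Fp.
have -> : jacobi_symbol (-1) p = -1.
  by rewrite -[p]expn1 jacobi_prime_pow // legendreN1_3mod4.
have -> : c_g2_pow_sub2 p (2 * s.+1) = p%:R ^+ (4 * s).
  rewrite /c_g2_pow_sub2 mulnS ltnNge leq_addr /= addnC addnK.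
  exact: c_g2_inert_pow.
by rewrite c_g2_inert_pow // mulnS exprD -[p%:Z]natz; ring.
Qed.

(** * Assembly of the two residue classes of p *)

Lemma odd_mod4 n : odd n -> n = 1 %[mod 4] \/ n = 3 %[mod 4].
Proof. lia. Qed.

Lemma even_exponent p r : p = 3 %[mod 4] -> (p ^ r = 1 %[mod 4])%N -> (0 < r)%N ->
  exists s, r = (2 * s.+1)%N.
Proof.
move=> p3 q1 r0; have rE := odd_double_half r.
have nor : ~~ odd r.
  apply/negP => odr; move: q1; rewrite -rE odr add1n expnS -mul2n expnM.
  have p2 : (p ^ 2 = 1 %[mod 4])%N by rewrite -modnXm p3.
  by rewrite -modnMm p3 -(modnXm r./2) p2 modnXm exp1n.
exists r./2.-1; move: rE; rewrite (negPf nor) add0n => rE.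
by rewrite prednK ?mul2n ?rE // -double_gt0 rE.
Qed.

Theorem proposition6p4 (p r : nat) (hp : prime p) (hp5 : (5 <= p)%N)
    (hr : (1 <= r)%N) (F : finFieldType) (hF : #|F| = (p ^ r)%N) :
  ((p ^ r)%N = 1%N %[mod 4] ->
     S_Leg F 3 = - 4 * (p%:Z ^+ r) + E3 p r) /\
  ((p ^ r)%N = 3%N %[mod 4] ->
     S_Leg F 3 = 0).
Proof.
split; last by move=> q3; apply: third_moment_3mod4; rewrite hF.
move=> q1; have po : odd p by case: (even_prime hp) => // p2; rewrite p2 in hp5.
have oq : odd (p ^ r) by rewrite oddX po orbT.
have oddF : odd #|F| by rewrite hF.
have N1 : qchar (-1 : F) = 1.
  by apply: (@qcharN1_1mod4 _ (p ^ r %/ 4)); rewrite hF {1}(divn_eq (p ^ r) 4) q1 mulnC.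
have [c [d [hcd hA ->]]] := third_moment_sum_squares oddF N1.
pose x := `|c|%N; pose y := `|d|%N.
have xE : c ^+ 2 = x%:R ^+ 2 by rewrite natz abszE real_normK ?num_real.
have yE : d ^+ 2 = y%:R ^+ 2 by rewrite natz abszE real_normK ?num_real.
rewrite xE yE hF natrX -[p%:Z]natz.
have exy : (x ^ 2 + y ^ 2 = (p ^ r).*2)%N.
  by apply/eqP; rewrite -(eqr_nat int) natrD !natrX -xE -yE hcd hF -muln2 natrM mulrC.
have [ox oy] := odd_of_sum_sqr oq exy.
have [p1|p3] := odd_mod4 po.
  rewrite (E3_1mod4 hp p1 hr ox oy exy); first by ring.
  (* If p divided c it would divide d, hence the Jacobsthal sum c + d. *)
  apply/negP => px; have /negP := jacobsthal_not_dvd hp hr p1 hF.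
  apply; rewrite hA rpredD ?dvdzE //.
  have : (p %| y ^ 2)%N.
    rewrite -(@dvdn_addr (x ^ 2)) ?dvdn_exp // exy -mul2n -(prednK hr) expnS.
    by rewrite mulnCA dvdn_mulr.
  by rewrite Euclid_dvdX // => /andP [].
have [s sE] := even_exponent p3 q1 hr.
(* For p = 3 modulo 4 the representation is forced: |c| = |d| = p^(s + 1), so c^2 d^2 = q^2. *)
have : (x, y) \in odd_reps (p ^ (2 * s.+1)) by rewrite mem_odd_reps /= ox oy -sE exy eqxx.
rewrite odd_reps_3mod4 // => /eqP [-> ->]; rewrite !natrX sE E3_3mod4 // -mulrA -!exprM.
rewrite (_ : (2 * s.+1 * 2 = 4 * s.+1)%N) 1?mulnAC // (mulnC s.+1) -exprD -mulnDl.
by ring.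
Qed.
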